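(* Assume that $N(s)$, $s\ge0$, is the mixed Poisson process with a structure cdf $L(\lambda)$, $\lambda\ge0$, and let $t>0$. Let each claim size $X_i$ depend only on the time $T_{i-1}$ of the previous claim and the inter-claim time $V_i=T_i-T_{i-1}$. Then $$ \mathbf{E}[S(t)]=\sum_{n=1}^\infty \pi^L_{t,n}\Bigg\{ n\int_0^t\mathbf{E}\big[X_1\,|\,T_1=y\big]\frac{(t-y)^{n-1}}{t^n}\,dy $$ $$ \qquad+\sum_{i=2}^n\frac{n!}{(i-2)!(n-i)!}\int_0^t\int_0^{t-x}\mathbf{E}\big[X_i\,|\,T_{i-1}=x,V_i=v\big]\frac{x^{i-2}(t-x-v)^{n-i}}{t^n}\,dv\,dx\Bigg\}. $$
   Context: Setting. $0<T_1<T_2<\cdots$ are the claim arrival times, with $T_0=0$ (and $T_i=\infty$ if there are fewer than $i$ claims); $V_i=T_i-T_{i-1}$ are the inter-claim times; $X_1,X_2,\dots$ are the corresponding claim sizes (random variables). $N(s)$ is the number of claims arriving up to and including time $s$, i.e. the largest integer $m$ with $T_m\le s$; $N(0)=0$. The aggregate claim size is $S(t)=\sum_{i=1}^{N(t)}X_i$, with $S(t)=0$ when $N(t)=0$. Mixed Poisson process with structure cdf $L$: there is a nonnegative random variable $\Lambda$ with cdf $L$ such that, conditionally on $\Lambda=\lambda$, $N$ is a homogeneous Poisson process with rate $\lambda$. Thus $$\pi^L_{t,n}=\mathbf{P}[N(t)=n]=\int_0^\infty\frac{(\lambda t)^n}{n!}e^{-\lambda t}\,dL(\lambda).$$ ''$X_i$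 depends only on $T_{i-1}$ and $V_i$'' means: on $\{T_i<\infty\}$, the conditional distribution of $X_i$ given the whole process $(N(s))_{s\ge0}$ is a function of $(T_{i-1},V_i)$ only. Conditional expectations $\mathbf{E}[X_i|T_{i-1}=x,V_i=v]$ denote the corresponding regression functions. Empty sums are $0$ and $0^0=1$. *)

(* Defs.v *)
From HB Require Import structures.
From mathcomp Require Import all_boot all_order all_algebra.
From mathcomp Require Import all_classical all_reals all_analysis.
From mathcomp Require Import measurable_realfun.

Set Implicit Arguments.
Unset Strict Implicit.
Unset Printing Implicit Defensive.

Import Order.TTheory GRing.Theory Num.Theory.
Import numFieldNormedType.Exports.

Local Open Scope classical_set_scope.
Local Open Scope ring_scope.
Local Open Scope ereal_scope.

Section claim_process.
Context {R : realType} {d : measure_display} {Omega : measurableType d}.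
Implicit Types (P : probability Omega R) (T : nat -> Omega -> \bar R)
  (N : R -> Omega -> nat).

(* [T i w = +oo] when the path [w] has fewer than [i] claims. *)
Definition arrival_times T : Prop :=
  forall w, T 0%N w = 0 /\
    forall i, T i w <= T i.+1 w /\ (T i w < +oo -> T i w < T i.+1 w).

(* [N s w] is the largest integer [m] with [T m w <= s]; its existence makes
   every path non-explosive. *)
Definition claim_number T N : Prop :=
  forall (s : R) w, (0 <= s)%R ->
    T (N s w) w <= s%:E /\ forall m, T m w <= s%:E -> (m <= N s w)%N.

(* The quantities T_(i-1) and V_i = T_i - T_(i-1), as reals: only meaningful
   on the event T_i < +oo. *)
Definition prev_time T (i : nat) (w : Omega) : R := fine (T i.-1 w).
Definition interclaim_time T (i : nat) (w : Omega) : R :=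
  (fine (T i w) - fine (T i.-1 w))%R.

Definition aggregate_claim N (X : nat -> Omega -> R) (t : R) (w : Omega) : R :=
  (\sum_(1 <= i < (N t w).+1) X i w)%R.

(* The library's [poisson_pmf] is constantly 1 at rate 0, hence it is not a
   probability mass function there; the rate 0 is needed here (with 0^0 = 1). *)
Definition poisson_weight (r : R) (n : nat) : R :=
  (r ^+ n / n`!%:R * expR (- r))%R.

(* Conditionally on [Lam = l], the increments of [N] over successive intervals
   are independent, Poisson with mean [l] times the length of the interval.
   The conditional probabilities are written in integrated form, over the
   events [Lam \in B]. *)
Definition conditionally_poisson P (Lam : Omega -> R) N : Prop :=
  forall (B : set R) (k : nat) (s : nat -> R) (n : nat -> nat),
    measurable B -> s 0%N = 0%R -> (forall j, (s j <= s j.+1)%R) ->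
    P (Lam @^-1` B `&`
       [set w | forall j, (j < k)%N -> N (s j.+1) w = (N (s j) w + n j)%N]) =
    \int[P]_(w in Lam @^-1` B)
      (\prod_(j < k) poisson_weight (Lam w * (s j.+1 - s j)) (n j))%:E.

Definition mixed_poisson P N (L : cumulativeBounded (0 : R) (1 : R)) : Prop :=
  exists Lam : {RV P >-> R},
    [/\ forall w, (0 <= Lam w)%R,
        forall l, cdf Lam l = (L l)%:E &
        conditionally_poisson P Lam N].

Definition mixed_poisson_prob (L : cumulativeBounded (0 : R) (1 : R))
    (t : R) (n : nat) : \bar R :=
  \int[lebesgue_stieltjes_measure L]_(l in `[0%R, +oo[)
    ((l * t) ^+ n / n`!%:R * expR (- (l * t)))%:E.

Definition process_sigma_algebra N : set (set Omega) :=
  <<s [set A | exists s k, (0 <= s)%R /\ A = [set w | N s w = k]] >>.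

(* On T_i < +oo, the conditional distribution of the [i]-th claim size [X]
   given the whole process [N] is [K (T_(i-1), V_i)]. *)
Definition depends_on_prev_interclaim P T N (i : nat) (X : Omega -> R) : Prop :=
  exists K : R.-pker (R * R)%type ~> R,
    forall (A : set Omega) (B : set R),
      process_sigma_algebra N A -> measurable B ->
      P (A `&` [set w | T i w < +oo] `&` X @^-1` B) =
      \int[P]_(w in A `&` [set w | T i w < +oo])
        K (prev_time T i w, interclaim_time T i w) B.

Section regression.
Context {d' : measure_display} {U : measurableType d'}.
Implicit Types (D : set Omega) (Y : Omega -> U).

(* [g y = E[Z | Y = y]] on the event [D], for a nonnegative [Z]; infinite
   values are allowed. *)
Definition ge0_regression P D (Z : Omega -> R) Y (g : U -> \bar R) : Prop :=
  [/\ measurable_fun [set: U] g, forall y, 0 <= g y &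
      forall B, measurable B ->
        \int[P]_(w in D `&` Y @^-1` B) (Z w)%:E =
        \int[P]_(w in D `&` Y @^-1` B) g (Y w)].

(* [g y = E[Z | Y = y]] on the event [D], for a signed [Z], by the usual
   E[Z | Y] = E[Z^+ | Y] - E[Z^- | Y]. The integrability of [Z] is not needed;
   [g] is unconstrained where both terms are infinite. *)
Definition regression P D (Z : Omega -> R) Y (g : U -> \bar R) : Prop :=
  measurable_fun [set: U] g /\
  exists gp gn : U -> \bar R,
    [/\ ge0_regression P D (Z^\+)%R Y gp, ge0_regression P D (Z^\-)%R Y gn &
        {ae P, forall w, D w -> gp (Y w) < +oo \/ gn (Y w) < +oo ->
          g (Y w) = gp (Y w) - gn (Y w)}].

End regression.
End claim_process.

(* Main.v *)
Require Import Defs.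
From HB Require Import structures.
From mathcomp Require Import all_boot all_order all_algebra.
From mathcomp Require Import all_classical all_reals all_analysis.
From mathcomp Require Import measurable_realfun.
From mathcomp Require Import ring lra zify.

Import Order.TTheory GRing.Theory Num.Theory.
Import numFieldNormedType.Exports.
Import HBNNSimple.

Local Open Scope classical_set_scope.
Local Open Scope ring_scope.
Local Open Scope ereal_scope.

(** The total is split over the events [N t = n]. On such an event it is the sum
    of [n] claims, so the theorem reduces to the expectation of a single [X i] over
    [N t = n].

    Because [X i] depends on the process through [(T_(i-1), V_i)] only, the
    regression function [m i], defined by its integrals over events in terms of
    this pair, also gives the expectation of [X i] over every event of the process
    ([regression_given_process]). Hence the expectation of [X i] over [N t = n]
    is the integral of [m i] against the joint law of [(T_(i-1), V_i)] on
    [N t = n].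

    That law does not depend on the mixture, except for its mass. By duality
    between arrivals and counts, the event that [T_(i-1) <= b], [c < T_i] and
    [N t = n], for [b <= c], says that [i - 1] claims arrive by time [b], none
    between [b] and [c], and [n - i + 1] after [c]. Its probability is
    [P (N t = n)] times a multinomial term, in which the rate has disappeared
    ([prob_claim_gap]). Such events form a pi-system, which identifies the law:
    its density on the simplex is, up to a constant, the product of [x ^ (i - 2)]
    and [(t - x - v) ^ (n - i)] ([claim_gap_law], and [first_claim_law] for
    [i = 1]). The double integral of the theorem is the iterated form of the
    integral over the simplex ([claim_gap_expectation]).

    The remaining work concerns infinities. For nonnegative claims all terms are
    nonnegative, up to null sets. When only the total is integrable, each claim is
    integrable over each event [N t = n]: by induction on [i] it is so over
    [N t = i], where [X i] is the last claim of the total, and the density for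
    [n] claims is bounded by the one for [i] claims ([integrable_claim]). Summation
    over [n] is then monotone convergence for the positive and negative parts of the
    total ([cvg_sum_integral_partition]). If the rate is almost surely zero, both
    sides vanish. *)

Set Implicit Arguments.
Unset Strict Implicit.
Unset Printing Implicit Defensive.

(** * Mixtures of measures *)

Section mixtures.
Context d d' (W : measurableType d) (Z : measurableType d') (R : realType).
Variables (mu : {measure set W -> \bar R}) (D : set W).
Variable k : W -> {measure set Z -> \bar R}.
Hypotheses (mD : measurable D)
  (mk : forall B, measurable B -> measurable_fun setT (fun w => k w B)).

Let integral_mixture_nnsfun (f : {nnsfun Z >-> R}) :
  \int[mu]_(w in D) \int[k w]_z (f z)%:E =
  \sum_(x \in range f) (x%:E * \int[mu]_(w in D) k w (f @^-1` [set x])).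
Proof.
have mkD B : measurable B -> measurable_fun D (fun w => k w B).
  by move=> mB; exact/measurable_funTS/mk.
under eq_integral do rewrite integralT_nnsfun sintegralE.
rewrite ge0_integral_fsum//; last 2 first.
- by move=> r; apply: measurable_funeM; exact: mkD.
- by move=> r w _; exact: nnsfun_mulemu_ge0.
apply: eq_fsbigr => r; rewrite inE => -[z _ <-].
by rewrite ge0_integralZl// ?lee_fin//; exact: mkD.
Qed.

Lemma integral_mixture_cvg (f : Z -> \bar R) (mf : measurable_fun setT f) :
  (forall z, 0 <= f z) ->
  (\sum_(x \in range (nnsfun_approx measurableT mf n))
     (x%:E * \int[mu]_(w in D) k w (nnsfun_approx measurableT mf n @^-1` [set x])))
    @[n --> \oo] --> \int[mu]_(w in D) \int[k w]_z f z.
Proof.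
move=> f0; set f_ := nnsfun_approx measurableT mf.
under eq_fun do rewrite -integral_mixture_nnsfun.
have f_nd w : {homo (fun n => \int[k w]_z (f_ n z)%:E) : a b / (a <= b)%N >-> a <= b}.
  move=> a b ab; apply: ge0_le_integral => //.
  - by move=> z _; rewrite lee_fin.
  - exact/measurable_EFinP.
  - exact/measurable_EFinP.
  - by move=> z _; rewrite lee_fin; exact/lefP/nd_nnsfun_approx.
have -> : \int[mu]_(w in D) \int[k w]_z f z =
    \int[mu]_(w in D) limn (fun n => \int[k w]_z (f_ n z)%:E).
  apply: eq_integral => w _; rewrite -monotone_convergence//.
  - by apply: eq_integral => z _; apply/esym/cvg_lim => //; exact: cvg_nnsfun_approx.
  - by move=> n; exact/measurable_EFinP.
  - by move=> n z _; rewrite lee_fin.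
  - by move=> z _ a b ab; rewrite lee_fin; exact/lefP/nd_nnsfun_approx.
apply: cvg_monotone_convergence => //.
- move=> n; apply/measurable_funTS/measurable_fun_integral_kernel => //.
  + by move=> z; rewrite lee_fin.
  + exact/measurable_EFinP.
- by move=> n w _; apply: integral_ge0 => z _; rewrite lee_fin.
Qed.

End mixtures.

(** A mixture integrates a simple function through its masses alone, and every
    nonnegative function is an increasing limit of simple functions: two
    mixtures with the same masses therefore have the same integrals. Kernels,
    images of measures and densities are all mixtures, so that this one
    approximation argument serves for the three of them. *)
Lemma eq_integral_mixture d1 d2 d' (W1 : measurableType d1)
    (W2 : measurableType d2) (Z : measurableType d') (R : realType)
    (mu1 : {measure set W1 -> \bar R}) (mu2 : {measure set W2 -> \bar R})
    (D1 : set W1) (D2 : set W2)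
    (k1 : W1 -> {measure set Z -> \bar R})
    (k2 : W2 -> {measure set Z -> \bar R}) (f : Z -> \bar R) :
  measurable D1 -> measurable D2 ->
  (forall B, measurable B -> measurable_fun setT (fun w => k1 w B)) ->
  (forall B, measurable B -> measurable_fun setT (fun w => k2 w B)) ->
  (forall B, measurable B ->
    \int[mu1]_(w in D1) k1 w B = \int[mu2]_(w in D2) k2 w B) ->
  measurable_fun setT f -> (forall z, 0 <= f z) ->
  \int[mu1]_(w in D1) \int[k1 w]_z f z = \int[mu2]_(w in D2) \int[k2 w]_z f z.
Proof.
move=> mD1 mD2 mk1 mk2 kE mf f0.
have c1 := integral_mixture_cvg (mu := mu1) mD1 mk1 mf f0.
have c2 := integral_mixture_cvg (mu := mu2) mD2 mk2 mf f0.
set s1 := fun n => _ in c1; set s2 := fun n => _ in c2.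
have s12 : s1 = s2 by apply/funext => n; apply: eq_fsbigr => r _; rewrite kE.
by rewrite -s12 in c2; exact: (cvg_unique _ c1 c2).
Qed.

Section transfer.
Context d d' (W : measurableType d) (Z : measurableType d') (R : realType).
Variables (mu : {measure set W -> \bar R}) (A : set W).
Hypothesis mA : measurable A.

Let measurable_dirac_comp (Y : W -> Z) B : measurable_fun setT Y ->
  measurable B -> measurable_fun setT (fun w => \d_(Y w) B : \bar R).
Proof.
move=> mY mB; apply: (measurableT_comp (f := fun z => \d_z B)) => //.
exact: measurable_fun_dirac.
Qed.

Let integral_dirac_comp (Y : W -> Z) B : measurable_fun setT Y ->
  measurable B -> \int[mu]_(w in A) \d_(Y w) B = mu (A `&` Y @^-1` B).
Proof.
move=> mY mB; under eq_integral do rewrite diracE.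
rewrite (eq_integral (EFin \o \1_(Y @^-1` B))); last first.
  by move=> w _ /=; rewrite indicE; congr (_%:R%:E); apply/idP/idP => /[!inE].
rewrite integral_indic//; first by rewrite setIC.
by rewrite -[_ @^-1` _]setTI; exact: mY.
Qed.

(** The joint law of [X] and the event [A] is a mixture of the Dirac masses at
    the points [X w]; the hypothesis compares it with the mixture of the
    measures [k w]. *)
Lemma ge0_integral_kernel_comp (X : W -> Z) (k : W -> {measure set Z -> \bar R})
    (f : Z -> \bar R) :
  measurable_fun setT X ->
  (forall B, measurable B -> measurable_fun setT (fun w => k w B)) ->
  (forall B, measurable B ->
    mu (A `&` X @^-1` B) = \int[mu]_(w in A) k w B) ->
  measurable_fun setT f -> (forall z, 0 <= f z) ->
  \int[mu]_(w in A) f (X w) = \int[mu]_(w in A) \int[k w]_z f z.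
Proof.
move=> mX mk XE mf f0.
rewrite -(@eq_integral_mixture _ _ _ _ _ _ _ mu mu A A
    (fun w => \d_(X w) : {measure set Z -> \bar R}) k)//.
- by apply: eq_integral => w _; rewrite integral_dirac// diracT mul1e.
- by move=> B mB; exact: measurable_dirac_comp.
- by move=> B mB; rewrite integral_dirac_comp//; exact: XE.
Qed.

Section density.
Variables (nu : {measure set Z -> \bar R}) (Y : W -> Z) (c : R) (w : Z -> R).
Hypotheses (mY : measurable_fun setT Y) (c0 : (0 < c)%R)
  (mw : measurable_fun setT w) (w0 : forall z, (0 <= w z)%R)
  (YE : forall B, measurable B ->
    mu (A `&` Y @^-1` B) = c%:E * \int[nu]_(z in B) (w z)%:E).

(* A density is a mixture of weighted Dirac masses. *)
Let kden z : {measure set Z -> \bar R} :=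
  mscale (NngNum (w0 z)) \d_z.

Lemma ge0_integral_density (f : Z -> \bar R) :
  measurable_fun setT f -> (forall z, 0 <= f z) ->
  \int[mu]_(x in A) f (Y x) = c%:E * \int[nu]_z (f z * (w z)%:E).
Proof.
move=> mf f0.
have mk B : measurable B -> measurable_fun setT (fun z => kden z B).
  move=> mB; rewrite /kden/mscale/=; apply: emeasurable_funM.
    exact/measurable_EFinP.
  exact: measurable_fun_dirac.
have mw' : measurable_fun setT (EFin \o w) by exact/measurable_EFinP.
have c0' : (0 <= c)%R by exact: ltW.
rewrite -ge0_integralZl//; last 2 first.
- by apply: emeasurable_funM.
- by move=> z _; rewrite mule_ge0// lee_fin.
transitivity (\int[mu]_(x in A) \int[\d_(Y x)]_z f z).
  by apply: eq_integral => x _; rewrite integral_dirac// diracT mul1e.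
pose kc z : {measure set Z -> \bar R} := mscale (NngNum c0') (kden z).
rewrite (@eq_integral_mixture _ _ _ _ _ _ _ mu nu A setT
    (fun x => \d_(Y x) : {measure set Z -> \bar R}) kc)//.
- apply: eq_integral => z _; rewrite /kc !ge0_integral_mscale//=.
  by rewrite integral_dirac// diracT mul1e [f z * _]muleC.
- by move=> B mB; exact: measurable_dirac_comp.
- move=> B mB; rewrite /kc/mscale/=; apply: measurable_funeM; exact: mk.
- move=> B mB; rewrite integral_dirac_comp// YE//.
  rewrite integral_mkcond -ge0_integralZl//; last 2 first.
  + by apply/(measurable_restrictT _ _).1 => //; exact: measurable_funTS.
  + by move=> z _; rewrite erestrict_ge0// => ? _; rewrite lee_fin.
  apply: eq_integral => z _; rewrite /kc/kden/mscale/= patchE ?/dirac.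
  rewrite -[RHS]/(c%:E * ((w z)%:E * (\1_B z)%:E)) indicE.
  by case: ifPn => _; rewrite ?mule1 ?mule0// -[point]/0 mule0.
Qed.

(** Multiplication by the positive real [c] commutes with the difference of the
    integrals of the two parts of [f] even when both are infinite, thanks to
    the convention [+oo - +oo = -oo]. *)
Lemma integral_density (f : Z -> \bar R) :
  measurable_fun setT f ->
  \int[mu]_(x in A) f (Y x) = c%:E * \int[nu]_z (f z * (w z)%:E).
Proof.
move=> mf; rewrite integralE [in RHS]integralE.
have -> : (fun z => f z * (w z)%:E)^\+ = (fun z => f^\+ z * (w z)%:E).
  by apply/funext => z; rewrite !funeposE maxe_pMl ?lee_fin// mul0e.
have -> : (fun z => f z * (w z)%:E)^\- = (fun z => f^\- z * (w z)%:E).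
  by apply/funext => z; rewrite !funenegE maxe_pMl ?lee_fin// mul0e mulNe.
rewrite (funepos_comp f Y) (funeneg_comp f Y)/=.
rewrite !ge0_integral_density//; last 2 first.
- exact: measurable_funeneg.
- exact: measurable_funepos.
have : 0 <= \int[nu]_z (f^\+ z * (w z)%:E).
  by apply: integral_ge0 => z _; rewrite mule_ge0// lee_fin.
have : 0 <= \int[nu]_z (f^\- z * (w z)%:E).
  by apply: integral_ge0 => z _; rewrite mule_ge0// lee_fin.
case: (\int[nu]_z (f^\- z * (w z)%:E)) => [b||] //; case: (\int[nu]_z (f^\+ z * (w z)%:E)) => [a||] // _ _.
- by rewrite -[RHS]/((c * (a - b))%:E) mulrBr.
- by rewrite gt0_muley ?lte_fin//= gt0_muley ?lte_fin.
- by rewrite gt0_muley ?lte_fin//= gt0_muleNy ?lte_fin.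
- by rewrite gt0_muley ?lte_fin//= gt0_muleNy ?lte_fin.
Qed.

End density.
End transfer.

(** * Uniqueness of regression functions *)

Section uniqueness_of_regression.
Context d d' (W : measurableType d) (Z : measurableType d') (R : realType).
Variables (mu : {finite_measure set W -> \bar R}) (D : set W) (Y : W -> Z).
Hypotheses (mD : measurable D) (mY : measurable_fun setT Y).

(* On the event [g <= k] both integrals are finite, whatever the values of [f]
   and [g] elsewhere; equal integrals there exclude [g < f]. *)
Let ae_le (f g : Z -> \bar R) :
  measurable_fun setT f -> measurable_fun setT g ->
  (forall z, 0 <= f z) -> (forall z, 0 <= g z) ->
  (forall B, measurable B -> \int[mu]_(w in D `&` Y @^-1` B) f (Y w) =
                             \int[mu]_(w in D `&` Y @^-1` B) g (Y w)) ->
  mu.-negligible (D `&` [set w | g (Y w) < f (Y w)]).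
Proof.
move=> mf mg f0 g0 fg.
pose C k := [set z | g z < f z] `&` [set z | g z <= k%:R%:E].
have mC k : measurable (C k).
  apply: measurableI; rewrite -[X in measurable X]setTI.
    exact: measurable_lte.
  exact: emeasurable_fun_infty_c.
pose E k := D `&` Y @^-1` C k.
have mE k : measurable (E k).
  by apply: measurableI => //; rewrite -[X in measurable X]setTI; exact: mY.
have mfY : measurable_fun setT (f \o Y) by exact: measurableT_comp.
have mgY : measurable_fun setT (g \o Y) by exact: measurableT_comp.
have -> : D `&` [set w | g (Y w) < f (Y w)] = \bigcup_k E k.
  apply/seteqP; split => [w [Dw /= gf]|w [k _ [Dw [/= gf _]]]]; last by split.
  have gfin : g (Y w) \is a fin_num.
    by rewrite ge0_fin_numE// (lt_le_trans gf)// leey.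
  exists (Num.truncn (fine (g (Y w)))).+1 => //; split => //; split => //=.
  by rewrite -(fineK gfin) lee_fin ltW// truncnS_gt.
apply: negligible_bigcup => k.
have gfin w : E k w -> g (Y w) \is a fin_num.
  by case=> _ [_ /= gk]; rewrite ge0_fin_numE// (le_lt_trans gk)// ltry.
have gk : \int[mu]_(w in E k) g (Y w) < +oo.
  apply: (@le_lt_trans _ _ (\int[mu]_(w in E k) (k%:R)%:E)).
    apply: ge0_le_integral => //.
    - exact: measurable_funTS.
    - by move=> w [_ [_ /=]].
  by rewrite integral_cst// lte_mul_pinfty ?lee_fin// -ge0_fin_numE// fin_num_measure.
have ig : mu.-integrable (E k) (g \o Y).
  apply/integrableP; split; first exact: measurable_funTS.
  by rewrite (eq_integral (g \o Y))// => w _ /=; rewrite gee0_abs.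
have if_ : mu.-integrable (E k) (f \o Y).
  apply/integrableP; split; first exact: measurable_funTS.
  rewrite (eq_integral (f \o Y)); last by move=> w _ /=; rewrite gee0_abs.
  by rewrite (fg _ (mC k)).
have fg0 : \int[mu]_(w in E k) `|f (Y w) - g (Y w)| = 0.
  transitivity (\int[mu]_(w in E k) ((f \o Y) \- (g \o Y)) w).
    apply: eq_integral => w; rewrite inE => Ew.
    rewrite gee0_abs// sube_ge0 ?(gfin _ Ew)//.
    by case: Ew => _ [/ltW].
  rewrite integralB//= (fg _ (mC k)) subee//.
  by rewrite ge0_fin_numE//; apply: integral_ge0.
have /(ae_eq_integral_abs mu (mE k)) [|]// := fg0.
  by apply: emeasurable_funB; exact: measurable_funTS.
move=> A [mA A0 subA]; exists A; split => // w Ew; apply: subA => /= H.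
have gf : g (Y w) < f (Y w) by case: Ew => _ [].
move: (H Ew) gf; rewrite -(fineK (gfin _ Ew)).
case: (f (Y w)) => [r| |] //= [/eqP]; rewrite subr_eq0 => /eqP ->.
by rewrite ltxx.
Qed.

Lemma ge0_regression_unique (f g : Z -> \bar R) :
  measurable_fun setT f -> measurable_fun setT g ->
  (forall z, 0 <= f z) -> (forall z, 0 <= g z) ->
  (forall B, measurable B -> \int[mu]_(w in D `&` Y @^-1` B) f (Y w) =
                             \int[mu]_(w in D `&` Y @^-1` B) g (Y w)) ->
  {ae mu, forall w, D w -> f (Y w) = g (Y w)}.
Proof.
move=> mf mg f0 g0 fg.
have h1 := ae_le mf mg f0 g0 fg.
have h2 := ae_le mg mf g0 f0 (fun B mB => esym (fg B mB)).
apply: negligibleS (negligibleU h1 h2) => w /= /not_implyP [Dw /eqP].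
by rewrite neq_lt => /orP[gf|gf]; [right|left].
Qed.

End uniqueness_of_regression.

(** * Iterated integrals and partitions *)

Section iterated_integral.
Context d1 d2 (T1 : measurableType d1) (T2 : measurableType d2) (R : realType).
Variables (m1 : {sigma_finite_measure set T1 -> \bar R})
  (m2 : {sigma_finite_measure set T2 -> \bar R}).

(** In the first case almost every section of [f^\-] has integral zero, and the
    identity is that of Tonelli for [f^\+]; the second case is Fubini. *)
Lemma integral_prod_iterated (f : T1 * T2 -> \bar R) :
  measurable_fun setT f ->
  \int[m1 \x m2]_z f^\- z = 0 \/ (m1 \x m2).-integrable setT f ->
  \int[m1]_x \int[m2]_y f (x, y) = \int[m1 \x m2]_z f z.
Proof.
move=> mf [fn0|fi]; last exact: (integral12_prod_meas1 fi).
pose Fp x := \int[m2]_y f^\+ (x, y).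
pose Fn x := \int[m2]_y f^\- (x, y).
have mFp : measurable_fun setT Fp.
  by apply: measurable_fun_fubini_tonelli_F => //; exact: measurable_funepos.
have mFn : measurable_fun setT Fn.
  by apply: measurable_fun_fubini_tonelli_F => //; exact: measurable_funeneg.
have FE x : \int[m2]_y f (x, y) = Fp x - Fn x.
  rewrite integralE; congr (_ - _).
  - by apply: eq_integral => y _; rewrite !funeposE.
  - by apply: eq_integral => y _; rewrite !funenegE.
have Fn0 : ae_eq m1 setT Fn (cst 0).
  apply/ae_eq_integral_abs => //.
  rewrite -[RHS]fn0 fubini_tonelli1//; last exact: measurable_funeneg.
  by apply: eq_integral => x _; rewrite gee0_abs//; exact: integral_ge0.
under eq_integral do rewrite FE.
transitivity (\int[m1]_x Fp x).
  apply: ae_eq_integral => //; first exact: emeasurable_funB.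
  by apply: filterS Fn0 => x /= /[apply] ->; rewrite sube0.
rewrite [RHS]integralE fn0 sube0 fubini_tonelli1//.
exact: measurable_funepos.
Qed.

End iterated_integral.

Section integral_over_partition.
Context d (W : measurableType d) (R : realType).
Variables (mu : {measure set W -> \bar R}) (A : (set W)^nat).
Hypotheses (mA : forall n, measurable (A n)) (tA : trivIset setT A)
  (AT : \bigcup_n A n = setT).

(** The partial sums are integrals over an increasing union of blocks, to which
    monotone convergence applies separately for the two parts of [f]; only the
    positive part may have an infinite integral. *)
Lemma cvg_sum_integral_partition (f : W -> R) :
  measurable_fun setT f ->
  \int[mu]_w (EFin \o f)^\- w < +oo ->
  \sum_(0 <= n < k) \int[mu]_(w in A n) (f w)%:E @[k --> \oo]
    --> \int[mu]_w (f w)%:E.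
Proof.
move=> mf fn.
have mf' : measurable_fun setT (EFin \o f) by exact/measurable_EFinP.
pose U k := \big[setU/set0]_(0 <= n < k) A n.
have mU k : measurable (U k) by exact: bigsetU_measurable.
have UT : \bigcup_k U k = setT.
  apply/seteqP; split => // w _; have [n _ Anw] : (\bigcup_n A n) w by rewrite AT.
  by exists n.+1 => //; rewrite /U big_mkord -bigcup_mkord; exists n => /=.
have ndU : nondecreasing_seq U.
  by move=> a b ab; rewrite /U !big_mkord; apply/subsetPset/subset_bigsetU.
have cv g : measurable_fun setT g -> (forall w, 0 <= g w) ->
    \int[mu]_(w in U k) g w @[k --> \oo] --> \int[mu]_w g w.
  move=> mg g0; rewrite -UT; apply: ge0_nondecreasing_set_cvg_integral => //.
  by move=> k; exact: measurable_funTS.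
rewrite [X in _ --> X]integralE.
under eq_fun => k.
  rewrite -(@integral_bigsetU_EFin _ _ _ mu)//; last 3 first.
  - by rewrite /index_iota iota_uniq.
  - exact: sub_trivIset tA.
  - exact: measurable_funTS.
  rewrite integralE; over.
apply: cvgeB.
- by rewrite fin_num_adde_defl// fin_numN ge0_fin_numE// integral_ge0.
- by apply: cv => //; exact: measurable_funepos.
- by apply: cv => //; exact: measurable_funeneg.
Qed.

End integral_over_partition.

Lemma integral_mulr_indic d (Z : measurableType d) (R : realType)
    (mu : {measure set Z -> \bar R}) (B S : set Z) (f : Z -> R) :
  \int[mu]_(z in B) (f z * \1_S z)%:E = \int[mu]_(z in B `&` S) (f z)%:E.
Proof.
rewrite integral_mkcondr; apply: eq_integral => z _; rewrite patchE indicE.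
by case: ifPn => _; rewrite ?mulr1 ?mulr0.
Qed.

Lemma integral_mulr_indicT d (Z : measurableType d) (R : realType)
    (mu : {measure set Z -> \bar R}) (S : set Z) (f : Z -> R) :
  \int[mu]_z (f z * \1_S z)%:E = \int[mu]_(z in S) (f z)%:E.
Proof. by rewrite integral_mulr_indic setTI. Qed.

Lemma integral_mule_indic d (Z : measurableType d) (R : realType)
    (mu : {measure set Z -> \bar R}) (S : set Z) (g : Z -> \bar R) (f : Z -> R) :
  \int[mu]_z (g z * (f z * \1_S z)%:E) = \int[mu]_(z in S) (g z * (f z)%:E).
Proof.
rewrite [RHS]integral_mkcond; apply: eq_integral => z _; rewrite patchE indicE.
by case: ifPn => _; rewrite ?mulr1// mulr0 mule0.
Qed.

(** * Paths of the claim process *)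

Section claim_paths.
Context (R : realType) d (Omega : measurableType d).
Variables (T : nat -> Omega -> \bar R) (N : R -> Omega -> nat).
Hypotheses (arrT : arrival_times T) (numN : claim_number T N).

Lemma arrival_nd w i j : (i <= j)%N -> T i w <= T j w.
Proof.
move=> /subnK <-; elim: (j - i)%N => [//|k IH]; rewrite addSn.
exact: le_trans IH ((arrT w).2 _).1.
Qed.

Lemma arrival_ge0 w i : 0 <= T i w.
Proof. by rewrite -(arrT w).1; exact: arrival_nd. Qed.

Lemma arrival_ltS w i : T i w < +oo -> T i w < T i.+1 w.
Proof. exact: ((arrT w).2 i).2. Qed.

(** The duality between counting and arrivals, through which every event on
    arrival times becomes an event on the counting process. *)
Lemma claim_number_leP (s : R) w i : (0 <= s)%R ->
  (T i w <= s%:E) = (i <= N s w)%N.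
Proof.
move=> s0; have [TN NT] := numN w s0; apply/idP/idP; first exact: NT.
by move=> iN; exact: le_trans (arrival_nd w iN) TN.
Qed.

Lemma claim_number_eqP (s : R) w n : (0 <= s)%R ->
  N s w = n <-> T n w <= s%:E < T n.+1 w.
Proof.
move=> s0; rewrite claim_number_leP// ltNge claim_number_leP// -ltnNge ltnS.
by split => [->|]; [rewrite leqnn | rewrite andbC -eqn_leq => /eqP].
Qed.

Lemma claim_number0 w : N 0%R w = 0%N.
Proof.
apply/claim_number_eqP => //; rewrite (arrT w).1 lexx /=.
by rewrite -[X in X < _](arrT w).1 arrival_ltS// (arrT w).1 ltry.
Qed.

Lemma arrival_fin_num (s : R) w i : (0 <= s)%R -> (i <= N s w)%N ->
  T i w \is a fin_num.
Proof.
move=> s0; rewrite -claim_number_leP// => Ts.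
by rewrite ge0_fin_numE ?arrival_ge0// (le_lt_trans Ts)// ltry.
Qed.

Lemma measurable_claim_number (s : R) n :
  (forall i, measurable_fun setT (T i)) -> (0 <= s)%R ->
  measurable [set w | N s w = n].
Proof.
move=> mT s0.
have -> : [set w | N s w = n] =
    [set w | T n w <= s%:E] `&` [set w | s%:E < T n.+1 w].
  by apply/seteqP; split => w /=; rewrite claim_number_eqP// => /andP.
apply: measurableI; rewrite -[X in measurable X]setTI.
  exact: emeasurable_fun_infty_c.
exact: emeasurable_fun_o_infty.
Qed.

Let OmegaN := g_sigma_algebraType
  [set A | exists s k, (0 <= s)%R /\ A = [set w | N s w = k]].

(** The event [r < T_i] is [N r < i], hence belongs to the sigma-algebra of the
    counting process. *)
Lemma process_measurable_arrival i : measurable_fun setT (T i : OmegaN -> \bar R).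
Proof.
apply: (measurability _ (ErealGenOInfty.measurableE R)) => _ [_ [r ->]] <-.
rewrite setTI preimage_itvoy.
have [r0|r0] := ltP r 0%R.
  rewrite [X in measurable X](_ : _ = setT)//; apply/seteqP; split => // w _ /=.
  by rewrite (lt_le_trans _ (arrival_ge0 w i))// lte_fin.
have -> : [set w | r%:E < T i w] = \bigcup_(k in `I_i) [set w | N r w = k].
  apply/seteqP; split => w /=; rewrite ltNge claim_number_leP// -ltnNge.
    by move=> Ni; exists (N r w).
  by move=> [k /= ki Nk]; rewrite Nk.
apply: bigcup_measurable => k _.
by apply: sub_sigma_algebra; exists r, k.
Qed.

Lemma process_sigma_algebra_preimage d' (U : measurableType d')
    (Y : Omega -> U) (B : set U) :
  measurable_fun setT (Y : OmegaN -> U) -> measurable B ->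
  process_sigma_algebra N (Y @^-1` B).
Proof.
by move=> mY mB; rewrite -[_ @^-1` _]setTI; exact: (mY measurableT B mB).
Qed.

Lemma process_measurable_prev_interclaim i : measurable_fun setT
  ((fun w => (prev_time T i w, interclaim_time T i w)) : OmegaN -> R * R).
Proof.
have mf j : measurable_fun setT ((fun w => fine (T j w)) : OmegaN -> R).
  by apply: measurableT_comp => //; exact: process_measurable_arrival.
apply: measurable_fun_pair; first exact: mf.
by apply: measurable_funB; exact: mf.
Qed.

End claim_paths.

(** * Mixed Poisson probabilities *)

Section mixed_poisson_laws.
Context (R : realType) d (Omega : measurableType d) (P : probability Omega R).
Variables (Lam : {RV P >-> R}) (N : R -> Omega -> nat)
  (L : cumulativeBounded (0 : R) (1 : R)).
Hypotheses (Lam0 : forall w, (0 <= Lam w)%R)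
  (LamL : forall l, cdf Lam l = (L l)%:E)
  (poiN : conditionally_poisson P Lam N)
  (N0 : forall w, N 0%R w = 0%N).

(* The Stieltjes measure is a measure on [measurableTypeR R], a copy of [R] with
   another structure of measurable space but the same measurable sets. *)
Let measurable_LamR : measurable_fun setT (Lam : Omega -> measurableTypeR R).
Proof. by move=> mT B mB; exact: (@measurable_funPT _ _ _ _ Lam mT B mB). Qed.

Let LamR : {mfun Omega >-> measurableTypeR R} :=
  HB.pack (Lam : Omega -> measurableTypeR R)
    (isMeasurableFun.Build _ _ _ _ _ measurable_LamR).

(* Both measures give [L b - L a] to the interval from [a] to [b]. *)
Let structure_distribution (B : set R) : measurable B ->
  lebesgue_stieltjes_measure L B = distribution P LamR B.
Proof.
move=> mB; apply: lebesgue_stieltjes_measure_unique mB => {B}.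
move=> I [[a b]]/= _ <-.
rewrite /lebesgue_stieltjes_measure /measure_extension/=.
rewrite measurable_mu_extE/=; last exact: is_ocitv.
have [ab | ba] := leP a b; last first.
  by rewrite set_itv_ge ?wlength0 ?measure0// bnd_simp -leNgt ltW.
rewrite wlength_itv_bnd// EFinB -!LamL /cdf.
have -> : `]a, b]%classic = `]-oo, b] `\` `]-oo, a] :> set R.
  by rewrite -[RHS]setCK setCD setCitvl setUC -[LHS]setCK setCitv.
rewrite measureD//= ?setIidr//; first exact: subset_itvl.
by rewrite -ge0_fin_numE// fin_num_measure.
Qed.

Lemma mixed_poisson_probE (t : R) n : (0 <= t)%R ->
  mixed_poisson_prob L t n = \int[P]_w (poisson_weight (Lam w * t) n)%:E.
Proof.
move=> t0; rewrite /mixed_poisson_prob.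
rewrite (@eq_measure_integral _ _ _ _ (distribution P LamR)); last first.
  by move=> A mA _; exact: structure_distribution.
rewrite ge0_integral_pushforward//.
- rewrite [X in \int[_]_(_ in X) _](_ : _ = setT)//.
  by apply/seteqP; split => // w _ /=; rewrite in_itv/= Lam0.
- apply/measurable_funTS/measurable_EFinP; apply: measurable_funM.
    apply: measurable_funM => //; apply: measurable_funX.
    exact: measurable_funM.
  apply: measurableT_comp => //; apply: measurable_funN.
  exact: measurable_funM.
- move=> l; rewrite inE /= in_itv/= andbT => l0.
  by rewrite lee_fin mulr_ge0 ?expR_ge0// divr_ge0// exprn_ge0// mulr_ge0.
Qed.

Let measurable_poisson_weight (t : R) n :
  measurable_fun setT (fun w => poisson_weight (Lam w * t) n).
Proof.
apply: measurable_funM.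
  apply: measurable_funM => //; apply: measurable_funX.
  exact: measurable_funM.
apply: measurableT_comp => //; apply: measurable_funN.
exact: measurable_funM.
Qed.

Let poisson_weight_ge0 (t : R) n w : (0 <= t)%R ->
  (0 <= poisson_weight (Lam w * t) n)%R.
Proof.
by move=> t0; rewrite mulr_ge0 ?expR_ge0// divr_ge0// exprn_ge0// mulr_ge0.
Qed.

(** The event says that [j] claims arrive in [(0, b]], none in [(b, c]] and [r]
    in [(c, t]]. Given the rate, its probability is the product of three Poisson
    weights, in which the rate enters only through its power [j + r] and the
    exponential: the rate can be integrated out, and what is left is the
    multinomial probability of the event given [N t = j + r]. *)
Lemma prob_claim_gap (b c t : R) (j r : nat) :
  (0 <= b)%R -> (b <= c)%R -> (c <= t)%R -> (0 < t)%R ->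
  P [set w | [/\ N b w = j, N c w = j & N t w = (j + r)%N]] =
  ((j + r)`!%:R / (j`!%:R * r`!%:R) * (b ^+ j * (t - c) ^+ r / t ^+ (j + r)))%:E
    * mixed_poisson_prob L t (j + r).
Proof.
move=> b0 bc ct t0.
pose s k := nth t [:: 0; b; c]%R k.
pose m k := nth 0%N [:: j; 0; r]%N k.
have sS k : (s k <= s k.+1)%R by case: k => [|[|[|k]]] //=; rewrite /s !nth_default.
have -> : [set w | [/\ N b w = j, N c w = j & N t w = (j + r)%N]] =
    Lam @^-1` setT `&` [set w | forall k, (k < 3)%N -> N (s k.+1) w = (N (s k) w + m k)%N].
  apply/seteqP; split => w /=.
    move=> [Nb Nc Nt]; split => // -[|[|[|k]]] //= _; rewrite /s/m/=.
    - by rewrite N0 add0n.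
    - by rewrite Nb Nc addn0.
    - by rewrite Nc Nt.
  move=> [_ Ns]; move: (Ns 0%N isT) (Ns 1%N isT) (Ns 2%N isT).
  by rewrite /s /m /= N0 add0n addn0 => -> -> ->.
rewrite poiN// preimage_setT mixed_poisson_probE ?ltW//.
rewrite -ge0_integralZl//; last 3 first.
- exact/measurable_EFinP.
- by move=> w _; rewrite lee_fin poisson_weight_ge0// ltW.
- rewrite lee_fin mulr_ge0// divr_ge0// ?mulr_ge0// ?exprn_ge0// ?subr_ge0//.
  exact: ltW.
apply: eq_integral => w _; rewrite -EFinM; congr (_%:E).
rewrite !big_ord_recl big_ord0 /bump /s /m /= mulr1.
rewrite subr0 /poisson_weight expr0 fact0.
have -> : expR (- (Lam w * t)) = (expR (- (Lam w * b)) *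
    (expR (- (Lam w * (c - b))) * expR (- (Lam w * (t - c)))))%R.
  by rewrite -!expRD; congr expR; ring.
rewrite !exprMn !exprD.
have j0 : (j`!%:R != 0 :> R)%R by rewrite pnatr_eq0 -lt0n fact_gt0.
have r0 : (r`!%:R != 0 :> R)%R by rewrite pnatr_eq0 -lt0n fact_gt0.
have jr0 : ((j + r)`!%:R != 0 :> R)%R by rewrite pnatr_eq0 -lt0n fact_gt0.
have tj0 : (t ^+ j != 0)%R by rewrite expf_neq0// gt_eqF.
have tr0 : (t ^+ r != 0)%R by rewrite expf_neq0// gt_eqF.
by field; rewrite ?j0 ?r0 ?jr0 ?tj0 ?tr0.
Qed.

(** The case [b = c = t] of [prob_claim_gap]. *)
Lemma mixed_poisson_prob_claim_number (t : R) n : (0 < t)%R ->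
  mixed_poisson_prob L t n = P [set w | N t w = n].
Proof.
move=> t0; have := @prob_claim_gap t t t n 0 (ltW t0) (lexx _) (lexx _) t0.
rewrite addn0 subrr expr0 fact0 !mulr1 !divff ?mulr1 ?mul1e; last 2 first.
- by rewrite expf_neq0// gt_eqF.
- by rewrite pnatr_eq0 -lt0n fact_gt0.
by move=> <-; congr (P _); apply/seteqP; split => w [].
Qed.

(** Each of these probabilities vanishes exactly when the rate is almost surely
    zero. *)
Lemma mixed_poisson_prob_eq0 (t : R) n k : (0 < t)%R ->
  (0 < n)%N -> (0 < k)%N ->
  mixed_poisson_prob L t n = 0 -> mixed_poisson_prob L t k = 0.
Proof.
move=> t0 n0 k0; rewrite !mixed_poisson_probE ?ltW// => pn0.
have : \int[P]_w `|(poisson_weight (Lam w * t) n)%:E| = 0.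
  rewrite -[RHS]pn0; apply: eq_integral => w _.
  by rewrite gee0_abs// lee_fin poisson_weight_ge0// ltW.
move/ae_eq_integral_abs => /(_ measurableT) H.
rewrite (ae_eq_integral (cst 0)) ?integral0//.
- exact/measurable_EFinP.
- have {}H := H (proj2 (measurable_EFinP _ _) (measurable_poisson_weight t n)).
  apply: filterS H => w /= /(_ I) [] /eqP; rewrite /poisson_weight.
  rewrite mulf_eq0 (gt_eqF (expR_gt0 _)) orbF mulf_eq0 invr_eq0 pnatr_eq0.
  rewrite (gtn_eqF (fact_gt0 n)) orbF expf_eq0 n0 /= => /eqP -> _.
  by rewrite expr0n gtn_eqF// !mul0r.
Qed.

End mixed_poisson_laws.

(** * Laws given by a density *)

Section density_measures.
Context d (Z : measurableType d) (R : realType).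
Variables (nu : {measure set Z -> \bar R}) (w : Z -> \bar R).
Hypotheses (mw : measurable_fun setT w) (w0 : forall z, 0 <= w z).

Definition density_measure (B : set Z) : \bar R := \int[nu]_(z in B) w z.

Let density0 : density_measure set0 = 0.
Proof. exact: integral_set0. Qed.

Let density_ge0 B : 0 <= density_measure B.
Proof. exact: integral_ge0. Qed.

Let density_semi_sigma_additive : semi_sigma_additive density_measure.
Proof.
move=> F mF tF mUF; rewrite /density_measure ge0_integral_bigcup//; last first.
  exact: measurable_funTS.
by apply: is_cvg_ereal_nneg_natsum_cond => n _ _; exact: integral_ge0.
Qed.

HB.instance Definition _ := isMeasure.Build _ _ _ density_measure
  density0 density_ge0 density_semi_sigma_additive.

End density_measures.

Section law_identification.
Context d d' (W : measurableType d) (Z : measurableType d') (R : realType).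
Variables (mu : {finite_measure set W -> \bar R}) (A : set W).
Variables (nu : {measure set Z -> \bar R}) (Y : W -> Z) (c : R) (w : Z -> R).
Hypotheses (mA : measurable A) (mY : measurable_fun setT Y) (c0 : (0 <= c)%R)
  (mw : measurable_fun setT w) (w0 : forall z, (0 <= w z)%R).

(** Both sides are measures in [B], finite on the covering sets, so that they
    agree as soon as they agree on a generating pi-system. *)
Lemma law_density_pi_system (G : set (set Z)) (g : (set Z)^nat) :
  measurable = <<s G >> -> setI_closed G -> (forall k, G (g k)) ->
  \bigcup_k g k = setT ->
  (forall B, G B -> mu (A `&` Y @^-1` B) = c%:E * \int[nu]_(z in B) (w z)%:E) ->
  forall B, measurable B ->
    mu (A `&` Y @^-1` B) = c%:E * \int[nu]_(z in B) (w z)%:E.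
Proof.
move=> sG GI Gg gT GE B mB.
have mw' : measurable_fun setT (fun z => (c * w z)%:E).
  by apply/measurable_EFinP; exact: measurable_funM.
have w0' z : 0 <= (c * w z)%:E by rewrite lee_fin mulr_ge0.
have dE C : measurable C ->
    c%:E * \int[nu]_(z in C) (w z)%:E = \int[nu]_(z in C) (c * w z)%:E.
  move=> mC; rewrite -ge0_integralZl//; first exact/measurable_funTS/measurable_EFinP.
  by move=> z _; rewrite lee_fin.
pose pm : {measure set Z -> \bar R} := pushforward (mrestr mu mA) Y.
pose pd : {measure set Z -> \bar R} :=
  density_measure nu (fun z => (c * w z)%:E).
pose m1 := pm mY; pose m2 := pd mw' w0'.
have m1E C : m1 C = mu (A `&` Y @^-1` C) by rewrite /m1 /pm/= /pushforward /mrestr/= setIC.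
rewrite -m1E dE// -[RHS]/(m2 B).
apply: (measure_unique G g) => //.
- move=> C GC; rewrite m1E GE// dE//.
  by rewrite sG; exact: sub_sigma_algebra.
- move=> k; rewrite m1E -ge0_fin_numE// fin_num_measure//.
  apply: measurableI => //; rewrite -[X in measurable X]setTI.
  by apply: mY => //; rewrite sG; exact: sub_sigma_algebra.
Qed.

End law_identification.

Lemma integral_itv_derive (R : realType) (F f : R -> R) (a b : R) :
  (a <= b)%R -> (forall x, is_derive x (1%R : R) F (f x)) -> continuous f ->
  \int[lebesgue_measure]_(x in `[a, b]) (f x)%:E = (F b - F a)%:E.
Proof.
rewrite le_eqVlt => /predU1P[->|ab] dF cf.
  by rewrite set_itv1 integral_set1 subrr.
have cF : continuous F.
  by move=> x; apply/differentiable_continuous/derivable1_diffP; exact: ex_derive.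
rewrite (continuous_FTC2 (F := F)) ?EFinB//.
- exact: continuous_subspaceT.
- split.
  + by move=> x _; exact: ex_derive.
  + exact/cvg_at_right_filter/cF.
  + exact/cvg_at_left_filter/cF.
- by move=> x _; rewrite derive1E; exact: derive_val.
Qed.

Lemma integral_itv_affineX (R : realType) (q e a b : R) m :
  (a <= b)%R -> (e != 0)%R ->
  \int[lebesgue_measure]_(x in `[a, b]) ((q + e * x) ^+ m)%:E =
  (((q + e * b) ^+ m.+1 - (q + e * a) ^+ m.+1) / (e * m.+1%:R))%:E.
Proof.
move=> ab e0.
pose F : R -> R := ((e * m.+1%:R)^-1 *: (cst q + e *: id) ^+ m.+1)%R.
have FE x : F x = ((e * m.+1%:R)^-1 * (q + e * x) ^+ m.+1)%R.
  by rewrite /F /GRing.scale/= exprfctE.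
have m0 : (m.+1%:R != 0 :> R)%R by rewrite pnatr_eq0.
have dF x : is_derive x (1%R : R) F ((q + e * x) ^+ m)%R.
  apply: is_derive_eq.
  rewrite /GRing.scale/= add0r mulr1 -mulr_natl.
  by field; rewrite nat1r m0 e0.
have cf : continuous (fun x => (q + e * x) ^+ m)%R.
  move=> x.
  apply: (@continuous_comp _ _ _ (fun y => q + e * y)%R (fun y => y ^+ m)%R).
    by apply: cvgD; [exact: cvg_cst|apply: cvgM; [exact: cvg_cst|exact: cvg_id]].
  exact: exprn_continuous.
rewrite (integral_itv_derive ab dF cf) !FE; congr EFin; field.
by rewrite nat1r m0 e0.
Qed.

Lemma integral_itv_subX (R : realType) (q a b : R) m : (a <= b)%R ->
  \int[lebesgue_measure]_(x in `[a, b]) ((q - x) ^+ m)%:E =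
  (((q - a) ^+ m.+1 - (q - b) ^+ m.+1) / m.+1%:R)%:E.
Proof.
move=> ab; under eq_integral do rewrite -mulN1r.
rewrite integral_itv_affineX ?oppr_eq0 ?oner_eq0// !mulN1r; congr EFin.
by rewrite invrN mulrN -mulNr opprB.
Qed.

Lemma integral_itv_exprn (R : realType) (b : R) k : (0 <= b)%R ->
  \int[lebesgue_measure]_(x in `[0%R, b]) (x ^+ k)%:E =
  (b ^+ k.+1 / k.+1%:R)%:E.
Proof.
move=> b0; have := integral_itv_affineX 0%R k b0 (oner_neq0 R).
rewrite !add0r !mul1r expr0n subr0 => <-.
by apply: eq_integral => x _; rewrite add0r mul1r.
Qed.

(** * Law of the first claim time *)

(** Given [N t = m + 1], the first claim time has density
    [(m + 1) * (t - y) ^ m / t ^ (m + 1)] on [[0, t]]; the factor [m + 1] is kept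
    apart, as part of the constant in [first_claim_law]. *)
Section first_claim_law.
Context (R : realType) d (Omega : measurableType d) (P : probability Omega R).
Variables (T : nat -> {RV P >-> \bar R}) (N : R -> Omega -> nat)
  (Lam : {RV P >-> R}) (L : cumulativeBounded (0 : R) (1 : R)) (t : R).
Hypotheses (arrT : arrival_times T) (numN : claim_number T N)
  (Lam0 : forall w, (0 <= Lam w)%R)
  (LamL : forall l, cdf Lam l = (L l)%:E)
  (poiN : conditionally_poisson P Lam N)
  (t0 : (0 < t)%R).

Definition first_claim_density (m : nat) (y : R) : R :=
  ((t - y) ^+ m / t ^+ m.+1 * \1_`[0%R, t] y)%R.

Lemma first_claim_density_ge0 m y : (0 <= first_claim_density m y)%R.
Proof.
rewrite /first_claim_density indicE; case: (boolP (_ \in _)); last by rewrite mulr0.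
rewrite inE/= in_itv/= => /andP[y0 yt].
by rewrite mulr1 divr_ge0// ?exprn_ge0// ?subr_ge0// ltW.
Qed.

Lemma measurable_first_claim_density m :
  measurable_fun setT (first_claim_density m).
Proof.
apply: measurable_funM; last exact: measurable_indic.
apply: measurable_funM => //; apply: measurable_funX; exact: measurable_funB.
Qed.

Let measurable_number n : measurable [set w | N t w = n].
Proof. by apply: (measurable_claim_number arrT numN) => //; exact: ltW. Qed.

Let integral_first_claim_density m c : (0 <= c)%R -> (c <= t)%R ->
  \int[lebesgue_measure]_(y in `[c, t]) ((t - y) ^+ m / t ^+ m.+1)%:E =
  ((t - c) ^+ m.+1 / (t ^+ m.+1 * m.+1%:R))%:E.
Proof.
move=> c0 ct.
under eq_integral do rewrite mulrC EFinM.
rewrite ge0_integralZl//; last 3 first.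
- by apply/measurable_EFinP/measurable_funX; exact: measurable_funB.
- move=> y; rewrite /= in_itv/= => /andP[_ yt].
  by rewrite lee_fin exprn_ge0// subr_ge0.
- by rewrite lee_fin invr_ge0 exprn_ge0// ltW.
rewrite integral_itv_subX// subrr expr0n subr0 -EFinM; congr EFin.
by rewrite mulrCA invfM mulrA.
Qed.

(** The half-lines form a pi-system, and no claim arrives before [c] exactly when
    [N c = 0]. *)
Lemma first_claim_law m (B : set R) : measurable B ->
  P ([set w | N t w = m.+1] `&` (fun w => fine (T 1%N w)) @^-1` B) =
  (fine (mixed_poisson_prob L t m.+1) * m.+1%:R)%:E *
    \int[lebesgue_measure]_(y in B) (first_claim_density m y)%:E.
Proof.
move=> mB.
have N0 := claim_number0 arrT numN.
have piE := mixed_poisson_prob_claim_number Lam0 LamL poiN N0 m.+1 t0.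
have pi_ge0 : (0 <= fine (mixed_poisson_prob L t m.+1))%R by rewrite fine_ge0// piE.
have pi_fin : mixed_poisson_prob L t m.+1 \is a fin_num by rewrite piE fin_num_measure.
apply: (@law_density_pi_system _ _ _ _ _ P _ lebesgue_measure _ _ _ _ _ _ _ _
  (@RGenOInfty.G R) (fun k => `](- k%:R)%R, +oo[%classic)).
- exact: measurable_number.
- by apply: measurableT_comp => //; exact: measurable_funPT.
- by rewrite mulr_ge0.
- exact: measurable_first_claim_density.
- exact: first_claim_density_ge0.
- exact: RGenOInfty.measurableE.
- move=> _ _ [x ->] [y ->]; exists (Num.max x y).
  by apply/seteqP; split => z /=; rewrite !in_itv/= !andbT gt_max => /andP.
- by move=> k; exists (- k%:R)%R.
- apply/seteqP; split => // x _; exists (Num.truncn `|x|).+1 => //=.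
  rewrite in_itv/= andbT ltrNl (le_lt_trans (ler_norm _))// normrN.
  exact: truncnS_gt.
move=> _ [x ->].
have Tfin w : N t w = m.+1 -> (T 1%N w = (fine (T 1%N w))%:E) * (0 < fine (T 1%N w) <= t)%R.
  move=> Nt; have T1 : T 1%N w \is a fin_num.
    by apply: (arrival_fin_num arrT numN (ltW t0)); rewrite Nt.
  split; first by rewrite fineK.
  rewrite -lte_fin -lee_fin fineK// (claim_number_leP arrT numN) ?Nt ?ltW//= andbT.
  by rewrite ltNge (claim_number_leP arrT numN)// N0.
have [tx|xt] := ltP t x.
  have -> : [set w | N t w = m.+1] `&` (fun w => fine (T 1%N w)) @^-1` `]x, +oo[ = set0.
    rewrite -subset0 => w [/= /Tfin[_ /andP[_ Tt]]]; rewrite in_itv/= andbT => xT.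
    by move: (lt_le_trans xT Tt); rewrite ltNge (ltW tx).
  rewrite measure0 integral0_eq ?mule0// => y; rewrite /= in_itv/= andbT => xy.
  rewrite /first_claim_density indicE memNset ?mulr0//= in_itv/= => /andP[_].
  by rewrite leNgt (lt_trans tx).
(* The first claim time is positive, so a half-line that starts below 0 may as
   well start at 0. *)
pose c := Num.max 0%R x.
have c0 : (0 <= c)%R by rewrite le_max lexx.
have ct : (c <= t)%R by rewrite ge_max (ltW t0) xt.
have -> : [set w | N t w = m.+1] `&` (fun w => fine (T 1%N w)) @^-1` `]x, +oo[ =
    [set w | [/\ N 0%R w = 0%N, N c w = 0%N & N t w = (0 + m.+1)%N]].
  apply/seteqP; split => w /=; rewrite in_itv/= andbT.
    move=> [Nt xT]; split => //; apply/eqP; rewrite -leqn0 leqNgt.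
    rewrite -(claim_number_leP arrT numN)// (Tfin _ Nt).1 lee_fin -ltNge gt_max xT.
    by case/andP: (Tfin _ Nt).2 => ->.
  move=> [_ Nc Nt]; split => //; move/eqP : Nc; rewrite -leqn0 leqNgt.
  rewrite -(claim_number_leP arrT numN)// (Tfin _ Nt).1 lee_fin -ltNge gt_max.
  by move=> /andP[].
apply: (etrans (prob_claim_gap Lam0 LamL poiN N0 _ _ (lexx _) c0 ct t0)).
have -> : \int[lebesgue_measure]_(y in `]x, +oo[) (first_claim_density m y)%:E =
    \int[lebesgue_measure]_(y in `[c, t]) ((t - y) ^+ m / t ^+ m.+1)%:E.
  rewrite integral_mulr_indic.
  have [x0|x0] := ltP x 0%R.
    rewrite /c max_l ?ltW//; congr (\int[_]_(_ in _) _).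
    apply/seteqP; split => y /=; rewrite !in_itv/= ?andbT; first by case.
    by move=> /andP[y0 yt]; rewrite y0 yt (lt_le_trans x0).
  rewrite /c max_r// -integral_itv_obnd_cbnd; last first.
    apply/measurable_funTS/measurable_EFinP; apply: measurable_funM => //.
    by apply: measurable_funX; exact: measurable_funB.
  congr (\int[_]_(_ in _) _); apply/seteqP; split => y /=; rewrite !in_itv/= ?andbT.
    by move=> [-> /andP[]].
  by move=> /andP[xy ->]; rewrite xy (le_trans x0 (ltW xy)).
rewrite integral_first_claim_density// add0n expr0 fact0 !mul1r.
rewrite -{1}(fineK pi_fin) -!EFinM; congr EFin.
have tm0 : (t ^+ m.+1 != 0)%R by rewrite expf_neq0// gt_eqF.
have m0 : (m.+1%:R != 0 :> R)%R by rewrite pnatr_eq0.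
have f0 : (m.+1`!%:R != 0 :> R)%R by rewrite pnatr_eq0 -lt0n fact_gt0.
by field; rewrite nat1r m0 f0 tm0.
exact: mB.
Qed.

End first_claim_law.

(** * Law of a claim time and the gap that follows it *)

Lemma measurable_set_ler d (Z : measurableType d) (R : realType) (f g : Z -> R) :
  measurable_fun setT f -> measurable_fun setT g ->
  measurable [set z | (f z <= g z)%R].
Proof.
move=> mf mg; rewrite -[X in measurable X]setTI.
exact: (measurable_fun_ler mf mg measurableT (Y := [set true])).
Qed.

Lemma measurable_set_ltr d (Z : measurableType d) (R : realType) (f g : Z -> R) :
  measurable_fun setT f -> measurable_fun setT g ->
  measurable [set z | (f z < g z)%R].
Proof.
move=> mf mg; rewrite -[X in measurable X]setTI.
exact: (measurable_fun_ltr mf mg measurableT (Y := [set true])).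
Qed.

(** The law of a claim time together with the gap that follows it is supported
    by the simplex of the pairs [(x, v)] with [0 <= x], [0 < v] and
    [x + v <= t]. The event that corresponds to [gap_set b c], for [b <= c],
    is that the claim comes by time [b] and the next one after time [c]: nothing
    happens in between, and the probability is a single product. These sets are
    closed under intersection, because [min b b' <= max c c'], and their traces
    on the simplex generate all Borel sets. *)
Section gap_pi_system.
Context (R : realType) (t : R).

Definition claim_simplex : set (R * R) :=
  [set z | [/\ (0 <= z.1)%R, (0 < z.2)%R & (z.1 + z.2 <= t)%R]].

Definition gap_set (b c : R) : set (R * R) :=
  [set z | (z.1 <= b)%R /\ (c < z.1 + z.2)%R] `&` claim_simplex.

(** Only the trace on the simplex is prescribed, so that the system contains
    every Borel set disjoint from the simplex and generates the Borel sets of the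
    whole plane. *)
Definition gap_system : set (set (R * R)) := [set B | measurable B /\
  (B `&` claim_simplex = set0 \/
   exists b c, [/\ (0 <= b)%R, (b <= c)%R, (c <= t)%R &
     B `&` claim_simplex = gap_set b c])].

Lemma measurable_claim_simplex : measurable claim_simplex.
Proof.
rewrite (_ : claim_simplex = [set z | (0 <= z.1)%R] `&` [set z | (0 < z.2)%R] `&`
    [set z | (z.1 + z.2 <= t)%R]); last first.
  by apply/seteqP; split => z /=; [case=> ? ? ?|case=> -[]].
apply: measurableI; [apply: measurableI|].
- exact: measurable_set_ler.
- exact: measurable_set_ltr.
- by apply: measurable_set_ler => //; exact: measurable_funD.
Qed.

Lemma measurable_gap_set b c : measurable (gap_set b c).
Proof.
apply: measurableI; last exact: measurable_claim_simplex.
rewrite (_ : mkset _ = [set z | (z.1 <= b)%R] `&` [set z | (c < z.1 + z.2)%R])//.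
apply: measurableI; first exact: measurable_set_ler.
by apply: measurable_set_ltr => //; exact: measurable_funD.
Qed.

Lemma gap_systemI : setI_closed gap_system.
Proof.
move=> A B [mA HA] [mB HB]; split; first exact: measurableI.
case: HA => [A0|[b [c [b0 bc ct AE]]]]; first by left; rewrite setIAC A0 set0I.
case: HB => [B0|[b' [c' [b0' bc' ct' BE]]]]; first by left; rewrite -setIA B0 setI0.
right; exists (Num.min b b'), (Num.max c c'); split.
- by rewrite le_min b0.
- by rewrite ge_min !le_max bc.
- by rewrite ge_max ct.
rewrite setIIl AE BE; apply/seteqP; split => z.
  move=> [[[/= zb zc] Uz] [[/= zb' zc'] _]].
  by split => //=; rewrite le_min gt_max zb zc zb' zc'.
move=> [[/=]]; rewrite le_min gt_max => /andP[zb zb'] /andP[zc zc'] Uz.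
by split; split.
Qed.

Let GT := g_sigma_algebraType gap_system.

Let sub_gap B : gap_system B -> measurable (B : set GT).
Proof. exact: sub_sigma_algebra. Qed.

Let gap_off B : measurable B -> measurable ((B `\` claim_simplex) : set GT).
Proof.
move=> mB; apply: sub_gap; split.
  by apply: measurableD => //; exact: measurable_claim_simplex.
by left; rewrite setDE -setIA setICl setI0.
Qed.

Let gap_system_diag q : gap_system (gap_set q q).
Proof.
split; first exact: measurable_gap_set.
have [/andP[q0 qt]|nq] := boolP (0 <= q <= t)%R.
  by right; exists q, q; split => //; rewrite /gap_set -setIA setIid.
left; rewrite -subset0 => z [[[/= zq qz] [z0 z20 zt] _]].
move: nq; rewrite (le_trans z0 zq)/= => /negP; apply.
by rewrite (le_trans (ltW qz)).
Qed.

Let gap_on q : measurable (gap_set q q : set GT).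
Proof. exact: sub_gap. Qed.

(* A point of the simplex satisfies [z.1 < q < z.1 + z.2] for some rational [q];
   hence half-planes in the variables [z.1] and [z.1 + z.2] are, within the
   simplex, countable unions of sets [gap_set q q]. *)
Let gap_rat z : claim_simplex z ->
  exists q : rat, (z.1 < ratr q)%R /\ (ratr q < z.1 + z.2)%R.
Proof.
move=> [_ z20 _]; have : (z.1 < z.1 + z.2)%R by rewrite ltrDl.
by move=> /rat_in_itvoo[q]; rewrite in_itv/= => /andP[? ?]; exists q.
Qed.

Let gap_union (I : pred R) (b : R) : measurable
  (\bigcup_(q : rat) (if I (ratr q) then gap_set (ratr q) (ratr q) else set0) `|`
   gap_set b b : set GT).
Proof.
apply: measurableU; last exact: gap_on.
by apply: bigcupT_measurable_rat => q; case: ifPn => // _; exact: gap_on.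
Qed.

Let measurable_fst_gap : measurable_fun setT (fst : GT -> R).
Proof.
apply: (measurability _ (RGenOInfty.measurableE R)) => _ [_ [b ->]] <-.
rewrite setTI; rewrite (_ : _ @^-1` _ = ~` [set z : GT | (z.1 <= b)%R]); last first.
  by apply/seteqP; split => z /=; rewrite in_itv/= andbT ltNge => /negP.
apply: measurableC.
rewrite (_ : mkset _ = ([set z | (z.1 <= b)%R] `\` claim_simplex) `|`
  (\bigcup_(q : rat) (if (ratr q <= b)%R then gap_set (ratr q) (ratr q) else set0)
   `|` gap_set b b)); last first.
  apply/seteqP; split => z /=.
    move=> zb; have [Uz|nUz] := pselect (claim_simplex z); last by left.
    right; have [zzb|bz] := leP (z.1 + z.2)%R b; last by right.
    have [q [zq qz]] := gap_rat Uz; left; exists q => //.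
    by rewrite (le_trans (ltW qz) zzb); split => //=; rewrite ltW.
  move=> [[]//|[[q _]|[[]]//]]; case: ifPn => // qb [[/= zq _] _].
  exact: le_trans zq qb.
apply: measurableU; last exact: (gap_union (fun q => q <= b)%R b).
by apply: gap_off; exact: measurable_set_ler.
Qed.

Let measurable_add_gap : measurable_fun setT ((fun z => z.1 + z.2)%R : GT -> R).
Proof.
apply: (measurability _ (RGenOInfty.measurableE R)) => _ [_ [c ->]] <-.
rewrite setTI.
rewrite (_ : _ @^-1` _ = ([set z | (c < z.1 + z.2)%R] `\` claim_simplex) `|`
  (\bigcup_(q : rat) (if (c <= ratr q)%R then gap_set (ratr q) (ratr q) else set0)
   `|` gap_set c c)); last first.
  apply/seteqP; split => z /=.
    rewrite in_itv/= andbT => zc.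
    have [Uz|nUz] := pselect (claim_simplex z); last by left.
    right; have [zzc|cz] := leP z.1 c; first by right.
    have [q [zq qz]] := gap_rat Uz; left; exists q => //.
    by rewrite (le_trans (ltW cz) (ltW zq)); split => //=; rewrite ltW.
  rewrite in_itv/= andbT.
  move=> [[]//|[[q _]|[[]]//]]; case: ifPn => // cq [[/= _ qz] _].
  exact: le_lt_trans cq qz.
apply: measurableU; last exact: (gap_union (fun q => c <= q)%R c).
by apply: gap_off; apply: measurable_set_ltr => //; exact: measurable_funD.
Qed.

(** The coordinates [z.1] and [z.1 + z.2] are measurable for the generated
    sigma-algebra, hence so is the identity. *)
Lemma gap_system_generates : measurable = <<s gap_system >>.
Proof.
apply/seteqP; split => B.
  move=> mB; have : measurable_fun setT (idfun : GT -> R * R).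
    apply/measurable_fun_pairP; split; first exact: measurable_fst_gap.
    rewrite [_ \o _](_ : _ = (fun z : GT => (z.1 + z.2) - z.1)%R).
      exact: measurable_funB measurable_add_gap measurable_fst_gap.
    by apply/funext => z /=; rewrite addrC addKr.
  by move=> /(_ measurableT _ mB); rewrite setTI.
apply: smallest_sub; first exact: sigma_algebra_measurable.
by move=> C [].
Qed.

Definition gap_cover (k : nat) : set (R * R) := ~` claim_simplex `|`
  (if unpickle k is Some q then gap_set (ratr q : R) (ratr q) else set0).

Lemma gap_cover_sub k : gap_system (gap_cover k).
Proof.
have U A : gap_system A -> gap_system (~` claim_simplex `|` A).
  move=> [mA HA]; split.
    by apply: measurableU => //; apply: measurableC; exact: measurable_claim_simplex.
  by rewrite setIUl setICl set0U.
rewrite /gap_cover; case: unpickle => [q|]; apply: U; first exact: gap_system_diag.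
by split => //; left; rewrite set0I.
Qed.

Lemma bigcup_gap_cover : \bigcup_k gap_cover k = setT.
Proof.
apply/seteqP; split => // z _.
have [Uz|nUz] := pselect (claim_simplex z); last by exists 0%N => //; left.
have [q [zq qz]] := gap_rat Uz; exists (pickle q) => //; right.
by rewrite pickleK; split => //=; rewrite ltW.
Qed.

End gap_pi_system.

Section claim_gap_law.
Context (R : realType) d (Omega : measurableType d) (P : probability Omega R).
Variables (T : nat -> {RV P >-> \bar R}) (N : R -> Omega -> nat)
  (Lam : {RV P >-> R}) (L : cumulativeBounded (0 : R) (1 : R)) (t : R).
Hypotheses (arrT : arrival_times T) (numN : claim_number T N)
  (Lam0 : forall w, (0 <= Lam w)%R)
  (LamL : forall l, cdf Lam l = (L l)%:E)
  (poiN : conditionally_poisson P Lam N)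
  (t0 : (0 < t)%R).

Local Notation simplex := (claim_simplex t).

Let gap_weight (k m : nat) (z : R * R) : R :=
  (z.1 ^+ k * (t - z.1 - z.2) ^+ m / t ^+ (k + m).+2)%R.

(** Up to a constant, the joint density of the time [z.1] of claim [k + 1] and of
    the gap [z.2] before claim [k + 2], given [N t = k + m + 2]: [k] claims come
    earlier, [m] claims come later. *)
Definition claim_gap_density (k m : nat) (z : R * R) : R :=
  (z.1 ^+ k * (t - z.1 - z.2) ^+ m / t ^+ (k + m).+2 * \1_simplex z)%R.

Let gap_weight_ge0 k m z : simplex z -> (0 <= gap_weight k m z)%R.
Proof.
move=> [z1 _ zt]; apply: divr_ge0; last by rewrite exprn_ge0// ltW.
by rewrite mulr_ge0 ?exprn_ge0// -addrA -opprD subr_ge0.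
Qed.

Lemma claim_gap_density_ge0 k m z : (0 <= claim_gap_density k m z)%R.
Proof.
rewrite /claim_gap_density indicE; case: (boolP (_ \in _)); last by rewrite mulr0.
by rewrite inE mulr1; exact: gap_weight_ge0.
Qed.

Let measurable_gap_weight k m : measurable_fun setT (gap_weight k m).
Proof.
apply: measurable_funM => //; apply: measurable_funM; apply: measurable_funX => //.
by apply: measurable_funB => //; exact: measurable_funB.
Qed.

Lemma measurable_claim_gap_density k m :
  measurable_fun setT (claim_gap_density k m).
Proof.
apply: (measurable_funM (measurable_gap_weight k m)).
by apply: measurable_indic; exact: measurable_claim_simplex.
Qed.

(* For [x <= b <= c], the section of [gap_set b c] at [x] is the interval
   [(c - x, t - x]], over which the integral depends on [x] through [x ^ k]
   only. *)
Let integral_gap_weight k m b c : (0 <= b)%R -> (b <= c)%R -> (c <= t)%R ->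
  \int[lebesgue_measure \x lebesgue_measure]_(z in gap_set t b c)
     (gap_weight k m z)%:E =
  (b ^+ k.+1 / k.+1%:R * ((t - c) ^+ m.+1 / m.+1%:R / t ^+ (k + m).+2))%:E.
Proof.
move=> b0 bc ct.
have mG := measurable_gap_set t b c.
rewrite -integral_mulr_indicT.
have mf : measurable_fun setT (fun z => (gap_weight k m z * \1_(gap_set t b c) z)%:E).
  by apply/measurable_EFinP; apply: measurable_funM => //; exact: measurable_indic.
have f0 z : 0 <= (gap_weight k m z * \1_(gap_set t b c) z)%:E.
  rewrite lee_fin indicE; case: (boolP (_ \in _)); last by rewrite mulr0.
  by rewrite inE mulr1 => -[_ Uz]; exact: gap_weight_ge0.
rewrite fubini_tonelli1//.
set C := ((t - c) ^+ m.+1 / m.+1%:R / t ^+ (k + m).+2)%R.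
have C0 : (0 <= C)%R by rewrite !divr_ge0 ?exprn_ge0 ?subr_ge0// ltW.
have inner x : \int[lebesgue_measure]_y
    (gap_weight k m (x, y) * \1_(gap_set t b c) (x, y))%:E =
    (C * x ^+ k * \1_`[0%R, b] x)%:E.
  rewrite [in RHS]indicE; case: (boolP (x \in _)); last first.
    rewrite notin_setE => xb; rewrite mulr0 integral0_eq// => y _.
    rewrite indicE memNset ?mulr0// => -[[/= xb' _] [/= x0 _ _]].
    by apply: xb; rewrite /= in_itv/= x0 xb'.
  rewrite inE/= in_itv/= mulr1 => /andP[x0 xb].
  transitivity (\int[lebesgue_measure]_(y in `](c - x)%R, (t - x)%R])
      (gap_weight k m (x, y))%:E).
    transitivity (\int[lebesgue_measure]_y
        (gap_weight k m (x, y) * \1_`](c - x)%R, (t - x)%R] y)%:E); last first.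
      exact: integral_mulr_indicT.
    apply: eq_integral => y _; congr (_%:E).
    congr *%R; rewrite !indicE; congr (_%:R); congr nat_of_bool.
    apply/idP/idP => /[!inE]; rewrite /= in_itv/=.
      by move=> [[/= _ cy] [/= _ _ yt]]; rewrite ltrBlDl cy lerBrDl.
    rewrite ltrBlDl lerBrDl => /andP[cy yt]; split => //; split => //=.
    by move: (lt_le_trans cy (lexx _)); lra.
  rewrite integral_itv_obnd_cbnd; last first.
    by apply/measurable_funTS/measurable_EFinP; exact: measurable_fun_pair2.
  rewrite /gap_weight/=.
  transitivity (\int[lebesgue_measure]_(y in `[(c - x)%R, (t - x)%R])
      ((x ^+ k / t ^+ (k + m).+2)%:E * ((t - x - y) ^+ m)%:E)).
    by apply: eq_integral => y _; rewrite -EFinM mulrAC.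
  rewrite ge0_integralZl//; last 3 first.
  - by apply/measurable_EFinP/measurable_funX; exact: measurable_funB.
  - move=> y; rewrite /= in_itv/= => /andP[_ yt].
    by rewrite lee_fin exprn_ge0// subr_ge0.
  - by rewrite lee_fin divr_ge0 ?exprn_ge0// ltW.
  rewrite integral_itv_subX ?lerB// -EFinM; congr EFin.
  have -> : (t - x - (c - x) = t - c)%R by ring.
  have -> : (t - x - (t - x) = 0)%R by ring.
  by rewrite expr0n subr0 /C; ring.
rewrite /fubini_F.
under eq_integral do rewrite inner.
rewrite integral_mulr_indicT.
under eq_integral do rewrite EFinM.
rewrite ge0_integralZl//; last 2 first.
- by apply/measurable_EFinP/measurable_funX.
- by move=> x; rewrite /= in_itv/= lee_fin => /andP[x0 _]; rewrite exprn_ge0.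
by rewrite integral_itv_exprn// -EFinM mulrC.
Qed.

(** On [gap_set b c] both sides are explicit: the left one by [prob_claim_gap]
    with [k + 1] claims before the gap and [m + 1] after it, the right one by
    integrating powers. *)
Lemma claim_gap_law k m (B : set (R * R)) : measurable B ->
  P ([set w | N t w = (k + m).+2] `&`
     (fun w => (prev_time T k.+2 w, interclaim_time T k.+2 w)) @^-1` B) =
  (fine (mixed_poisson_prob L t (k + m).+2) *
     ((k + m).+2`!%:R / (k`!%:R * m`!%:R)))%:E *
    \int[lebesgue_measure \x lebesgue_measure]_(z in B)
      (claim_gap_density k m z)%:E.
Proof.
move=> mB; set n := (k + m).+2; pose Y w := (prev_time T k.+2 w, interclaim_time T k.+2 w).
have N0 := claim_number0 arrT numN.
have piE := mixed_poisson_prob_claim_number Lam0 LamL poiN N0 n t0.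
have mN : measurable [set w | N t w = n].
  by apply: (measurable_claim_number arrT numN) => //; exact: ltW.
have pi_ge0 : (0 <= fine (mixed_poisson_prob L t n))%R by rewrite piE fine_ge0.
have pi_fin : mixed_poisson_prob L t n \is a fin_num by rewrite piE fin_num_measure.
have Tfin w i : N t w = n -> (i <= n)%N -> T i w = (fine (T i w))%:E.
  move=> Nt im; rewrite fineK//.
  by apply: (arrival_fin_num arrT numN (ltW t0)); rewrite Nt.
have k1n : (k.+1 <= n)%N by rewrite /n; lia.
have k2n : (k.+2 <= n)%N by rewrite /n; lia.
have YU w : N t w = n -> simplex (Y w).
  move=> Nt; rewrite /Y/prev_time/interclaim_time/=; split => /=.
  - by rewrite fine_ge0//; exact: (arrival_ge0 arrT).
  - rewrite subr_gt0 -lte_fin -!Tfin//.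
    apply: (arrival_ltS arrT); by rewrite (Tfin w k.+1)// ltry.
  - rewrite addrC subrK -lee_fin -Tfin//.
    by rewrite (claim_number_leP arrT numN) ?ltW// Nt.
have mfT i : measurable_fun setT (fun w => fine (T i w)).
  by apply: measurableT_comp => //; exact: measurable_funPT.
have onU (B' : set (R * R)) : [set w | N t w = n] `&` Y @^-1` B' =
    [set w | N t w = n] `&` Y @^-1` (B' `&` simplex).
  apply/seteqP; split => w [Nt YB]; split => //; last by case: YB.
  by split => //; exact: YU.
apply: (@law_density_pi_system _ _ _ _ _ P _ (lebesgue_measure \x lebesgue_measure)
  _ _ _ _ _ _ _ _ (gap_system t) (gap_cover t)).
- exact: mN.
- apply: measurable_fun_pair; first exact: mfT.
  by apply: measurable_funB; exact: mfT.
- by rewrite !mulr_ge0// invr_ge0 mulr_ge0.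
- exact: measurable_claim_gap_density.
- exact: claim_gap_density_ge0.
- exact: gap_system_generates.
- exact: gap_systemI.
- exact: gap_cover_sub.
- exact: bigcup_gap_cover.
- move=> C [mC CU]; rewrite onU.
  have -> : \int[lebesgue_measure \x lebesgue_measure]_(z in C)
        (claim_gap_density k m z)%:E =
      \int[lebesgue_measure \x lebesgue_measure]_(z in C `&` simplex)
        (gap_weight k m z)%:E by exact: integral_mulr_indic.
  case: CU => [->|[b [c [b0 bc ct ->]]]].
    by rewrite preimage_set0 setI0 measure0 integral_set0 mule0.
  have -> : [set w | N t w = n] `&` Y @^-1` gap_set t b c =
      [set w | [/\ N b w = k.+1, N c w = k.+1 & N t w = (k.+1 + m.+1)%N]].
    have kmn : (k.+1 + m.+1 = n)%N by rewrite /n; lia.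
    rewrite kmn; apply/seteqP; split => w /=.
      move=> [Nt [[/=]]]; rewrite /prev_time/interclaim_time/= addrC subrK.
      rewrite -lee_fin -lte_fin -!Tfin//.
      rewrite (claim_number_leP arrT numN)// ltNge (claim_number_leP arrT numN) ?(le_trans b0)//.
      rewrite -ltnNge => kb ck _.
      have bcN : (N b w <= N c w)%N.
        rewrite -(claim_number_leP arrT numN) ?(le_trans b0)//.
        apply: (@le_trans _ _ b%:E); last by rewrite lee_fin.
        by rewrite (claim_number_leP arrT numN).
      by split => //; lia.
    move=> [Nb Nc Nt]; split => //; split; last exact: YU.
    rewrite /Y/prev_time/interclaim_time/= addrC subrK.
    rewrite -lee_fin -lte_fin -!Tfin//.
    rewrite (claim_number_leP arrT numN)// ltNge (claim_number_leP arrT numN) ?(le_trans b0)//.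
    by rewrite Nb Nc leqnn ltnn.
  apply: (etrans (prob_claim_gap Lam0 LamL poiN N0 _ _ b0 bc ct t0)).
  have -> : (k.+1 + m.+1 = n)%N by rewrite /n; lia.
  rewrite integral_gap_weight// -{1}(fineK pi_fin) -!EFinM; congr EFin.
  have tn0 : (t ^+ n != 0)%R by rewrite expf_neq0// gt_eqF.
  have k0 : (k`!%:R != 0 :> R)%R by rewrite pnatr_eq0 -lt0n fact_gt0.
  have m0 : (m`!%:R != 0 :> R)%R by rewrite pnatr_eq0 -lt0n fact_gt0.
  have k1 : (k.+1%:R != 0 :> R)%R by rewrite pnatr_eq0.
  have m1 : (m.+1%:R != 0 :> R)%R by rewrite pnatr_eq0.
  rewrite !factS !natrM -/n.
  by field; rewrite !nat1r k0 m0 k1 m1 tn0.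
- exact: mB.
Qed.

End claim_gap_law.

(** * Regression given the claim process *)

(** The variable [Y] carries the pair [(T_(i-1), V_i)] through [phi]: it is
    that pair for [2 <= i], and the first claim time for [i = 1], where
    [T_0 = 0]. *)
Section expectation_given_process.
Context (R : realType) d (Omega : measurableType d) (P : probability Omega R).
Variables (T : nat -> {RV P >-> \bar R}) (N : R -> Omega -> nat).
Hypotheses (arrT : arrival_times T) (numN : claim_number T N).

Lemma process_sigma_algebra_measurable A :
  process_sigma_algebra N A -> measurable A.
Proof.
apply: smallest_sub; first exact: sigma_algebra_measurable.
move=> _ [s [k [s0 ->]]]; exact: (measurable_claim_number arrT numN).
Qed.

Let measurable_arrived i : measurable [set w | T i w < +oo].
Proof.
by rewrite -[X in measurable X]setTI; apply: emeasurable_fun_infty_o.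
Qed.

Lemma measurable_prev_interclaim i : measurable_fun setT
  (fun w => (prev_time T i w, interclaim_time T i w)).
Proof.
have mf j : measurable_fun setT (fun w => fine (T j w)).
  by apply: measurableT_comp => //; exact: measurable_funPT.
by apply: measurable_fun_pair; [exact: mf|apply: measurable_funB; exact: mf].
Qed.

Variables (d' : measure_display) (U : measurableType d') (i : nat)
  (X : {RV P >-> R}) (Y : Omega -> U) (phi : U -> R * R).
Hypotheses (XN : depends_on_prev_interclaim P T N i X)
  (mphi : measurable_fun setT phi) (mY : measurable_fun setT Y)
  (phiY : forall w, (prev_time T i w, interclaim_time T i w) = phi (Y w))
  (YN : forall B, measurable B -> process_sigma_algebra N (Y @^-1` B)).

(** The kernel yields one regression function valid over all events of the
    process, [h]. Over the events in terms of [Y] it has the same integrals as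
    [g], hence agrees with [g] almost surely, and [g] inherits its property
    over every event [A] of the process, for instance [N t = n]. *)
Lemma regression_given_process (f : R -> R) (g : U -> \bar R) A :
  measurable_fun setT f -> (forall x, (0 <= f x)%R) ->
  ge0_regression P [set w | T i w < +oo] (fun w => f (X w)) Y g ->
  process_sigma_algebra N A -> A `<=` [set w | T i w < +oo] ->
  \int[P]_(w in A) (f (X w))%:E = \int[P]_(w in A) g (Y w).
Proof.
move=> mf f0 [mg g0 gE] NA AD.
have mD := measurable_arrived i.
have [K KE] := XN; set D := [set w | T i w < +oo] in gE AD KE mD *.
pose h u := \int[K (phi u)]_x (f x)%:E.
have mK B : measurable B -> measurable_fun setT (fun u => K (phi u) B).
  by move=> mB; apply: (measurableT_comp (f := fun y => K y B)) => //; exact: measurable_kernel.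
have mf' : measurable_fun setT (fun x => (f x)%:E) by exact/measurable_EFinP.
have f0' x : 0 <= (f x)%:E by rewrite lee_fin.
have mh : measurable_fun setT h by exact: measurable_fun_integral_kernel.
have h0 u : 0 <= h u by exact: integral_ge0.
have hE A' : process_sigma_algebra N A' ->
    \int[P]_(w in A' `&` D) (f (X w))%:E = \int[P]_(w in A' `&` D) h (Y w).
  move=> NA'; apply: (@ge0_integral_kernel_comp _ _ _ _ _ P _ _ X
    (fun w => K (phi (Y w))) (fun x => (f x)%:E)) => //.
  - by apply: measurableI; [exact: process_sigma_algebra_measurable|exact: measurable_arrived].
  - by move=> B mB; exact: (measurableT_comp (mK _ mB) mY).
  - move=> B mB; apply: (etrans (KE _ _ NA' mB)).
    by apply: eq_integral => w _; rewrite phiY.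
have hg : {ae P, forall w, D w -> h (Y w) = g (Y w)}.
  apply: ge0_regression_unique => // B mB.
  by rewrite -gE// setIC -hE//; exact: YN.
have mA := process_sigma_algebra_measurable NA.
rewrite -(setIidl AD) hE//; apply: ge0_ae_eq_integral.
- exact: measurableI.
- by apply: measurable_funTS; exact: measurableT_comp.
- by apply: measurable_funTS; exact: measurableT_comp.
- by move=> w _; exact: h0.
- by move=> w _; exact: g0.
- by apply: filterS hg => w /= hgw [_ /hgw].
Qed.

(** Signed case of the same identity; the two alternatives are those under which
    the difference of the two regressions is meaningful on [A]. *)
Lemma signed_regression_given_process (g : U -> \bar R) A :
  regression P [set w | T i w < +oo] X Y g ->
  process_sigma_algebra N A -> A `<=` [set w | T i w < +oo] ->
  (forall w, (0 <= X w)%R) \/ P.-integrable A (EFin \o X) ->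
  \int[P]_(w in A) (X w)%:E = \int[P]_(w in A) g (Y w) /\
  (\int[P]_(w in A) g^\- (Y w) = 0 \/ P.-integrable A (g \o Y)).
Proof.
move=> [mg [gp [gn [rp rn gE]]]] NA AD.
have mA := process_sigma_algebra_measurable NA.
have mX : measurable_fun setT X by exact: measurable_funPT.
have [mgp gp0 gpE] := rp; have [mgn gn0 gnE] := rn.
have mgY : measurable_fun A (g \o Y) by apply: measurable_funTS; exact: measurableT_comp.
have mgpY : measurable_fun A (gp \o Y) by apply: measurable_funTS; exact: measurableT_comp.
have mgnY : measurable_fun A (gn \o Y) by apply: measurable_funTS; exact: measurableT_comp.
have pE : \int[P]_(w in A) ((X^\+)%R w)%:E = \int[P]_(w in A) gp (Y w).
  apply: (regression_given_process (f := fun x => Num.max x 0%R)) => //.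
  - exact: measurable_maxr.
  - by move=> x; rewrite le_max lexx orbT.
have nE : \int[P]_(w in A) ((X^\-)%R w)%:E = \int[P]_(w in A) gn (Y w).
  apply: (regression_given_process (f := fun x => Num.max (- x)%R 0%R)) => //.
  - by apply: measurable_maxr => //; exact: measurable_funN.
  - by move=> x; rewrite le_max lexx orbT.
move=> [X0|iX].
  have Xn0 : (X^\-)%R = cst 0%R.
    by apply/funext => w; rewrite /funrneg/=; apply/max_idPr; rewrite oppr_le0.
  have Xp : (X^\+)%R = X :> (_ -> _).
    by apply/funext => w; rewrite /funrpos/=; apply/max_idPl.
  have gnY0 : ae_eq P A (gn \o Y) (cst 0).
    apply/ae_eq_integral_abs => //; under eq_integral do rewrite gee0_abs//=.
    by rewrite -nE Xn0 integral0.
  have gY : ae_eq P A (g \o Y) (gp \o Y).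
    move: gnY0 gE; apply: filterS2 => w /= gn0w gEw Aw.
    rewrite gEw; [by rewrite gn0w// sube0|exact: AD|].
    by right; rewrite gn0w// ltry.
  split; first by rewrite -{1}Xp pE; apply/esym/ae_eq_integral.
  left; transitivity (\int[P]_(w in A) (cst 0 w : \bar R)); last exact: integral0.
  apply: ae_eq_integral => //.
    apply: measurable_funTS; apply: measurableT_comp => //.
    exact: measurable_funeneg.
  apply: filterS gY => w /= gYw Aw; rewrite funenegE gYw//.
  by apply/max_idPr; rewrite oppe_le0.
have ip : P.-integrable A (gp \o Y).
  apply/integrableP; split => //.
  rewrite (eq_integral (gp \o Y)); last by move=> w _ /=; rewrite gee0_abs.
  rewrite -pE -ge0_fin_numE.
    by have := integrable_pos_fin_num mA iX; rewrite funerpos.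
  by apply: integral_ge0 => w _; rewrite lee_fin funrpos_ge0.
have in_ : P.-integrable A (gn \o Y).
  apply/integrableP; split => //.
  rewrite (eq_integral (gn \o Y)); last by move=> w _ /=; rewrite gee0_abs.
  rewrite -nE -ge0_fin_numE.
    by have := integrable_neg_fin_num mA iX; rewrite funerneg.
  by apply: integral_ge0 => w _; rewrite lee_fin funrneg_ge0.
have gY : ae_eq P A (g \o Y) ((gp \o Y) \- (gn \o Y)).
  move: (integrable_ae mA in_) gE; apply: filterS2 => w /= gnf gEw Aw.
  by rewrite gEw; [|exact: AD|right; have := gnf Aw; rewrite ge0_fin_numE].
have mB : measurable_fun A ((gp \o Y) \- (gn \o Y)) by exact: emeasurable_funB.
have ig : P.-integrable A (g \o Y).
  apply/integrableP; split => //.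
  rewrite (@ae_eq_integral _ _ _ P A (abse \o ((gp \o Y) \- (gn \o Y))))//.
  - by have /integrableP[] := integrableB mA ip in_.
  - exact: measurableT_comp.
  - exact: measurableT_comp.
  - exact: ae_eq_abse.
split; last by right.
transitivity (\int[P]_(w in A) ((gp \o Y) \- (gn \o Y)) w); last first.
  by apply/esym/ae_eq_integral.
rewrite integralB//= -pE -nE.
by rewrite [LHS]integralE funerpos funerneg.
Qed.

End expectation_given_process.

(** For an event [A] of the process on which [Y] has a density, expectations over
    [A] become integrals of the regression function against that density. *)
Section expectation_given_law.
Context (R : realType) d (Omega : measurableType d) (P : probability Omega R).
Variables (T : nat -> {RV P >-> \bar R}) (N : R -> Omega -> nat).
Hypotheses (arrT : arrival_times T) (numN : claim_number T N).
Variables (d' : measure_display) (U : measurableType d') (i : nat)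
  (X : {RV P >-> R}) (Y : Omega -> U) (phi : U -> R * R)
  (nu : {measure set U -> \bar R}) (g : U -> \bar R).
Hypotheses (XN : depends_on_prev_interclaim P T N i X)
  (mphi : measurable_fun setT phi) (mY : measurable_fun setT Y)
  (phiY : forall w, (prev_time T i w, interclaim_time T i w) = phi (Y w))
  (YN : forall B, measurable B -> process_sigma_algebra N (Y @^-1` B))
  (Xg : regression P [set w | T i w < +oo] X Y g).

Definition has_density (A : set Omega) (c : R) (w : U -> R) := [/\
  process_sigma_algebra N A /\ A `<=` [set x | T i x < +oo],
  (0 < c)%R, measurable_fun setT w, (forall u, (0 <= w u)%R) &
  forall B, measurable B ->
    P (A `&` Y @^-1` B) = c%:E * \int[nu]_(u in B) (w u)%:E].

Lemma integral_claim_density A c w : has_density A c w ->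
  (forall x, (0 <= X x)%R) \/ P.-integrable A (EFin \o X) ->
  \int[P]_(x in A) (X x)%:E = c%:E * \int[nu]_u (g u * (w u)%:E) /\
  (\int[nu]_u (fun u => g u * (w u)%:E)^\- u = 0 \/
   nu.-integrable setT (fun u => g u * (w u)%:E)).
Proof.
move=> [[NA AD] c0 mw w0 lawA] HX.
have mA := process_sigma_algebra_measurable arrT numN NA.
have mg : measurable_fun setT g by case: Xg.
have mgw : measurable_fun setT (fun u => g u * (w u)%:E).
  by apply: emeasurable_funM => //; exact/measurable_EFinP.
have [-> Hg] := signed_regression_given_process arrT numN XN mphi mY phiY YN Xg NA AD HX.
split; first exact: integral_density.
case: Hg => [gn0|/integrableP[_ gi]]; [left|right].
  have -> : (fun u => g u * (w u)%:E)^\- = (fun u => g^\- u * (w u)%:E).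
    by apply/funext => u; rewrite !funenegE maxe_pMl ?lee_fin// mul0e mulNe.
  move: gn0; rewrite (ge0_integral_density mA mY c0 mw w0 lawA)//; last first.
    exact: measurable_funeneg.
  by move/eqP; rewrite mule_eq0 eqe gt_eqF//= => /eqP.
apply/integrableP; split => //.
move: gi; have -> : \int[P]_(x in A) `|(g \o Y) x| =
    c%:E * \int[nu]_u (`|g u| * (w u)%:E).
  apply: (ge0_integral_density mA mY c0 mw w0 lawA (f := fun u => `|g u|)) => //.
  exact: measurableT_comp.
rewrite [in X in _ -> X](eq_integral (fun u => `|g u| * (w u)%:E)); last first.
  by move=> u _; rewrite abseM; congr (_ * _); rewrite gee0_abs ?lee_fin.
have : 0 <= \int[nu]_u (`|g u| * (w u)%:E).
  by apply: integral_ge0 => u _; rewrite mule_ge0// lee_fin.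
case: (\int[nu]_u _) => [r||]//= _; first by rewrite !ltry.
by rewrite gt0_muley// lte_fin.
Qed.

(** The expectation over [A] of each part of [X] is the integral of a regression
    function that does not depend on [A]. Comparing densities thus carries
    integrability from one event to another. *)
Lemma integrable_claim_density_le A0 c0 w0 A1 c1 w1 :
  has_density A0 c0 w0 -> has_density A1 c1 w1 ->
  (forall u, (w1 u <= w0 u)%R) ->
  P.-integrable A0 (EFin \o X) -> P.-integrable A1 (EFin \o X).
Proof.
move=> [[NA0 AD0] c0_gt0 mw0 w0_ge0 law0] [[NA1 AD1] c1_gt0 mw1 w1_ge0 law1] w10 iX.
have mA0 := process_sigma_algebra_measurable arrT numN NA0.
have mA1 := process_sigma_algebra_measurable arrT numN NA1.
have mX : measurable_fun setT X by exact: measurable_funPT.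
have [_ [gp [gn [rp rn _]]]] := Xg.
have part (f : R -> R) (h : U -> \bar R) : measurable_fun setT f ->
    (forall x, (0 <= f x)%R) ->
    ge0_regression P [set w | T i w < +oo] (fun w => f (X w)) Y h ->
    \int[P]_(x in A0) (f (X x))%:E < +oo ->
    P.-integrable A1 (fun x => (f (X x))%:E).
  move=> mf f0 rh; have [mh h0 _] := rh.
  have reg := regression_given_process arrT numN XN mphi mY phiY YN mf f0 rh.
  rewrite reg// (ge0_integral_density mA0 mY c0_gt0 mw0 w0_ge0 law0)// => fin0.
  apply/integrableP; split.
    by apply/measurable_funTS/measurable_EFinP; exact: measurableT_comp.
  rewrite (eq_integral (fun x => (f (X x))%:E)); last first.
    by move=> x _; rewrite gee0_abs// lee_fin.
  rewrite reg// (ge0_integral_density mA1 mY c1_gt0 mw1 w1_ge0 law1)//.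
  have le10 : \int[nu]_u (h u * (w1 u)%:E) <= \int[nu]_u (h u * (w0 u)%:E).
    apply: ge0_le_integral => //.
    - by move=> u _; rewrite mule_ge0// lee_fin.
    - by apply: emeasurable_funM => //; exact/measurable_EFinP.
    - by apply: emeasurable_funM => //; exact/measurable_EFinP.
    - by move=> u _; apply: lee_wpmul2l => //; rewrite lee_fin.
  have I0 : 0 <= \int[nu]_u (h u * (w0 u)%:E).
    by apply: integral_ge0 => u _; rewrite mule_ge0// lee_fin.
  rewrite lte_mul_pinfty// ?lee_fin ?ltW//.
  apply: (le_lt_trans le10); move: fin0 I0; case: (\int[nu]_u (_ * (w0 _)%:E)) => [r||]//.
    by move=> _ _; rewrite ltry.
  by rewrite gt0_muley// lte_fin.
have ip : P.-integrable A1 (fun x => (Num.max (X x) 0)%:E)%R.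
  apply: (part (fun x => Num.max x 0%R) gp) => //.
  - exact: measurable_maxr.
  - by move=> x; rewrite le_max lexx orbT.
  - have := integrable_pos_fin_num mA0 iX; rewrite funerpos.
    by rewrite ge0_fin_numE//; apply: integral_ge0 => x _; rewrite lee_fin funrpos_ge0.
have in_ : P.-integrable A1 (fun x => (Num.max (- X x) 0)%:E)%R.
  apply: (part (fun x => Num.max (- x)%R 0%R) gn) => //.
  - by apply: measurable_maxr => //; exact: measurable_funN.
  - by move=> x; rewrite le_max lexx orbT.
  - have := integrable_neg_fin_num mA0 iX; rewrite funerneg.
    by rewrite ge0_fin_numE//; apply: integral_ge0 => x _; rewrite lee_fin funrneg_ge0.
apply: eq_integrable (integrableB mA1 ip in_) => // x _ /=.
by rewrite -EFinB; congr EFin; have := congr1 (fun h => h x) (funrposBneg X).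
Qed.

End expectation_given_law.

(** * Expectation of one claim size *)

Section claim_expectations.
Context (R : realType) d (Omega : measurableType d) (P : probability Omega R).
Variables (T : nat -> {RV P >-> \bar R}) (N : R -> Omega -> nat)
  (Lam : {RV P >-> R}) (L : cumulativeBounded (0 : R) (1 : R)) (t : R).
Hypotheses (arrT : arrival_times T) (numN : claim_number T N)
  (Lam0 : forall w, (0 <= Lam w)%R)
  (LamL : forall l, cdf Lam l = (L l)%:E)
  (poiN : conditionally_poisson P Lam N)
  (t0 : (0 < t)%R).

Local Notation pi := (mixed_poisson_prob L t).
Local Notation A n := [set w | N t w = n].

Let N0 := claim_number0 arrT numN.

Lemma mixed_poisson_prob_fin n : pi n \is a fin_num.
Proof.
rewrite (mixed_poisson_prob_claim_number Lam0 LamL poiN N0)// fin_num_measure//.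
by apply: (measurable_claim_number arrT numN) => //; exact: ltW.
Qed.

Let pi_gt0 n : pi n != 0 -> (0 < fine (pi n))%R.
Proof.
move=> pin0; rewrite fine_gt0// lt0e pin0/=; apply/andP; split.
  by rewrite (mixed_poisson_prob_claim_number Lam0 LamL poiN N0).
by have := mixed_poisson_prob_fin n; rewrite fin_numElt => /andP[].
Qed.

Let process_number n : process_sigma_algebra N (A n).
Proof. by apply: sub_sigma_algebra; exists t, n; split => //; exact: ltW. Qed.

Let number_arrived n i : (i <= n)%N -> A n `<=` [set w | T i w < +oo].
Proof.
move=> ni w /= Nt; rewrite -ge0_fin_numE ?(arrival_ge0 arrT)//.
by apply: (arrival_fin_num arrT numN (ltW t0)); rewrite Nt.
Qed.

Section first.
Variables (X : {RV P >-> R}) (g : R -> \bar R).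
Hypotheses (XN : depends_on_prev_interclaim P T N 1 X)
  (Xg : regression P [set w | T 1%N w < +oo] X (fun w => fine (T 1%N w)) g).

(* Lebesgue measure is a measure on [measurableTypeR R], a copy of [R] with
   another structure of measurable space but the same measurable sets. *)
Let U := measurableTypeR R.
Let Y (w : Omega) : U := fine (T 1%N w).

Let XgU : regression (U := U) P [set w | T 1%N w < +oo] X Y g.
Proof. exact Xg. Qed.

Let mY : measurable_fun setT Y.
Proof.
have mY' : measurable_fun setT (Y : Omega -> R).
  by apply: measurableT_comp => //; exact: measurable_funPT.
exact mY'.
Qed.

Let mphi : measurable_fun setT (fun y : U => (0%R : R, y : R)).
Proof.
have mphi' : measurable_fun setT (fun y : R => (0%R : R, y)).
  exact: measurable_fun_pair.
exact mphi'.
Qed.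

Let phiY w : (prev_time T 1 w, interclaim_time T 1 w) = (0%R, Y w).
Proof. by rewrite /prev_time /interclaim_time /= (arrT w).1 subr0. Qed.

Let YN (B : set U) : measurable B -> process_sigma_algebra N (Y @^-1` B).
Proof.
apply: (@process_sigma_algebra_preimage _ _ _ _ _ R (Y : Omega -> R)).
apply: measurableT_comp => //.
exact: (process_measurable_arrival arrT numN).
Qed.

Let density m : pi m.+1 != 0 ->
  has_density T N 1 Y lebesgue_measure (A m.+1)
    (fine (pi m.+1) * m.+1%:R) (first_claim_density t m).
Proof.
move=> pin0; split.
- by split; [exact: process_number|exact: number_arrived].
- by rewrite mulr_gt0// pi_gt0.
- exact: measurable_first_claim_density.
- exact: first_claim_density_ge0.
- by move=> B mB; exact (first_claim_law arrT numN Lam0 LamL poiN t0 m mB).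
Qed.

Lemma first_claim_expectation m : pi m.+1 != 0 ->
  (forall w, (0 <= X w)%R) \/ P.-integrable (A m.+1) (EFin \o X) ->
  \int[P]_(w in A m.+1) (X w)%:E =
  pi m.+1 * (m.+1%:R%:E * \int[lebesgue_measure]_(y in `[0%R, t])
       (g y * ((t - y) ^+ m / t ^+ m.+1)%:E)).
Proof.
move=> pin0 HX.
have [-> _] := integral_claim_density arrT numN XN mphi mY phiY YN XgU (density pin0) HX.
rewrite EFinM fineK ?mixed_poisson_prob_fin// -muleA; congr (_ * (_ * _)).
exact: integral_mule_indic.
Qed.

(** The density of the first claim time given [N t = m + 1] is at most a constant
    times its density given [N t = 1], which is uniform. *)
Lemma first_claim_integrable m : pi 1%N != 0 -> pi m.+1 != 0 ->
  P.-integrable (A 1%N) (EFin \o X) -> P.-integrable (A m.+1) (EFin \o X).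
Proof.
move=> p1 pm; apply: (integrable_claim_density_le arrT numN XN mphi mY phiY YN XgU
  (density p1) (density pm)) => y.
rewrite /first_claim_density indicE; case: (boolP (_ \in _)); last by rewrite !mulr0.
rewrite inE/= in_itv/= => /andP[y0 yt].
rewrite !mulr1 expr0 exprSr invfM mulrA expr1.
rewrite ler_wpM2r ?invr_ge0 ?(ltW t0)// ler_pdivrMr ?exprn_gt0// mul1r.
by rewrite lerXn2r ?nnegrE ?subr_ge0 ?(ltW t0)// gerBl.
Qed.

End first.

Section gap.
Variables (k : nat) (X : {RV P >-> R}) (g : R * R -> \bar R).
Hypotheses (XN : depends_on_prev_interclaim P T N k.+2 X)
  (Xg : regression P [set w | T k.+2 w < +oo] X
    (fun w => (prev_time T k.+2 w, interclaim_time T k.+2 w)) g).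

Let U := (measurableTypeR R * measurableTypeR R)%type.
Let Y (w : Omega) : U := (prev_time T k.+2 w, interclaim_time T k.+2 w).

Let XgU : regression (U := U) P [set w | T k.+2 w < +oo] X Y g.
Proof. exact Xg. Qed.

Let mY : measurable_fun setT Y.
Proof. exact (measurable_prev_interclaim T k.+2). Qed.

Let mphi : measurable_fun setT (fun z : U => (z : R * R)).
Proof. exact (@measurable_id _ (R * R)%type setT). Qed.

Let phiY w : (prev_time T k.+2 w, interclaim_time T k.+2 w) = Y w.
Proof. by []. Qed.

Let YN (B : set U) : measurable B -> process_sigma_algebra N (Y @^-1` B).
Proof.
apply: (@process_sigma_algebra_preimage _ _ _ _ _ (R * R)%type Y).
exact: (process_measurable_prev_interclaim arrT numN).
Qed.

Let density m : pi (k + m).+2 != 0 ->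
  has_density T N k.+2 Y (lebesgue_measure \x lebesgue_measure) (A (k + m).+2)
    (fine (pi (k + m).+2) * ((k + m).+2`!%:R / (k`!%:R * m`!%:R)))
    (claim_gap_density t k m).
Proof.
move=> pin0; split.
- by split; [exact: process_number|apply: number_arrived; lia].
- by rewrite mulr_gt0 ?pi_gt0// divr_gt0 ?mulr_gt0// ltr0n fact_gt0.
- exact: measurable_claim_gap_density.
- exact: claim_gap_density_ge0.
- by move=> B mB; exact (claim_gap_law arrT numN Lam0 LamL poiN t0 k m mB).
Qed.

Lemma claim_gap_expectation m : pi (k + m).+2 != 0 ->
  (forall w, (0 <= X w)%R) \/ P.-integrable (A (k + m).+2) (EFin \o X) ->
  \int[P]_(w in A (k + m).+2) (X w)%:E =
  pi (k + m).+2 * (((k + m).+2`!%:R / (k`!%:R * m`!%:R))%:E *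
     \int[lebesgue_measure]_(x in `[0%R, t])
       \int[lebesgue_measure]_(v in `[0%R, (t - x)%R])
         (g (x, v) * (x ^+ k * (t - x - v) ^+ m / t ^+ (k + m).+2)%:E)).
Proof.
move=> pin0 HX.
have [-> Hg] := integral_claim_density arrT numN XN mphi mY phiY YN XgU (density pin0) HX.
rewrite EFinM fineK ?mixed_poisson_prob_fin// -muleA; congr (_ * (_ * _)).
have [mg _] := XgU.
transitivity (\int[lebesgue_measure]_x \int[lebesgue_measure]_v
    (g (x, v) * (claim_gap_density t k m (x, v))%:E)).
  apply/esym; refine (integral_prod_iterated _ Hg).
  apply: emeasurable_funM => //; apply/measurable_EFinP.
  exact (measurable_claim_gap_density t k m).
rewrite [RHS]integral_mkcond; apply: eq_integral => x _; rewrite patchE.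
case: ifPn; last first.
  rewrite notin_setE => xt; rewrite integral0_eq// => v _.
  rewrite /claim_gap_density indicE memNset ?mulr0 ?mule0// => -[/= x0 v0 xv].
  by apply: xt; rewrite /= in_itv/= x0/=; lra.
rewrite inE/= in_itv/= => /andP[x0 xt].
rewrite -integral_itv_obnd_cbnd; last first.
  apply: measurable_funTS; apply: emeasurable_funM.
    exact: measurable_fun_pair2.
  apply/measurable_EFinP; apply: measurable_funM => //; apply: measurable_funM => //.
  by apply: measurable_funX; exact: measurable_funB.
transitivity (\int[lebesgue_measure]_v (g (x, v) *
    (x ^+ k * (t - x - v) ^+ m / t ^+ (k + m).+2 * \1_`]0%R, (t - x)%R] v)%:E)).
  apply: eq_integral => v _; congr (_ * _%:E).
  rewrite /claim_gap_density/=; congr *%R; rewrite !indicE; congr (_%:R).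
  congr nat_of_bool; apply/idP/idP => /[!inE]; rewrite /= in_itv/=.
    by move=> [/= _ v0 xv]; apply/andP; split => //; lra.
  by move=> /andP[v0 vt]; split => //=; lra.
exact (integral_mule_indic lebesgue_measure `]0%R, (t - x)%R]%classic
  (fun v => g (x, v)) (fun v => x ^+ k * (t - x - v) ^+ m / t ^+ (k + m).+2)%R).
Qed.

(** The density given [N t = k + m + 2] is at most a constant times the density
    given [N t = k + 2], since the factor [((t - x - v) / t) ^ m] is at most 1. *)
Lemma claim_gap_integrable m : pi k.+2 != 0 -> pi (k + m).+2 != 0 ->
  P.-integrable (A k.+2) (EFin \o X) ->
  P.-integrable (A (k + m).+2) (EFin \o X).
Proof.
move=> pk pm; have := density (m := 0); rewrite addn0 => /(_ pk) dk.
apply: (integrable_claim_density_le arrT numN XN mphi mY phiY YN XgU dk (density pm)) => z.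
rewrite /claim_gap_density indicE; case: (boolP (_ \in _)); last by rewrite !mulr0.
rewrite inE => -[z1 z2 zt]; rewrite !mulr1 addn0.
set s := (t - z.1 - z.2)%R; have s0 : (0 <= s)%R by rewrite /s; lra.
have st : (s <= t)%R by rewrite /s; lra.
have -> : (z.1 ^+ k * s ^+ m / t ^+ (k + m).+2 =
    z.1 ^+ k / t ^+ k.+2 * (s ^+ m / t ^+ m))%R.
  have tk0 : (t ^+ k.+2 != 0)%R by rewrite expf_neq0// gt_eqF.
  have tm0 : (t ^+ m != 0)%R by rewrite expf_neq0// gt_eqF.
  rewrite -!addSn exprD; field.
  by rewrite tk0 tm0.
rewrite ler_piMr//; last first.
  by rewrite ler_pdivrMr ?exprn_gt0// mul1r lerXn2r ?nnegrE ?(ltW t0).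
by apply: divr_ge0; rewrite exprn_ge0// ltW.
Qed.

End gap.

End claim_expectations.

(** * Expected aggregate claim *)

(** Distributivity may fail in the extended reals when infinite terms of both
    signs occur; either alternative excludes that. *)
Lemma mule_sumr_pos (R : realType) (n : nat) (p : \bar R) (b : 'I_n -> \bar R) :
  0 < p -> p \is a fin_num ->
  (forall j, 0 <= p * b j) \/ (forall j, p * b j \is a fin_num) ->
  p * \sum_(j < n) b j = \sum_(j < n) p * b j.
Proof.
move=> p0 pfin [b0|bf].
  by apply: ge0_sume_distrr => j _; have := b0 j; rewrite pmule_rge0.
apply: fin_num_sume_distrr => // i j _ _; apply: fin_num_adde_defl.
have := bf j; case: (b j) => [r||]//; rewrite fin_numE.
- by rewrite gt0_muley.
- by rewrite gt0_muleNy.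
Qed.

Section integrable_claims.
Context (R : realType) d (Omega : measurableType d) (P : probability Omega R).
Variables (N : Omega -> nat) (X : nat -> {RV P >-> R}).
Local Notation A n := [set w | N w = n].
Local Notation S w := (\sum_(1 <= i < (N w).+1) X i w)%R.
Hypotheses (mA : forall n, measurable (A n))
  (iS : P.-integrable setT (fun w => (S w)%:E))
  (step : forall i n, (1 <= i <= n)%N ->
    P.-integrable (A i) (EFin \o X i) -> P.-integrable (A n) (EFin \o X i)).

(** Claims may compensate each other in the total, so the integrability of a
    single claim is obtained by induction: on the event that exactly [i] claims
    arrive, [X i] is the total minus the previous claims, and [step] carries its
    integrability to the events with more claims. *)
Lemma integrable_claim i n : (1 <= i <= n)%N -> P.-integrable (A n) (EFin \o X i).
Proof.
elim/ltn_ind: i n => i IH n /andP[i1 ile]; apply: step; first by rewrite i1.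
have iSi : P.-integrable (A i) (fun w => (S w)%:E) by exact: integrableS iS.
have ip : P.-integrable (A i) (fun w => \sum_(j < i.-1) (X j.+1 w)%:E).
  apply: integrable_sum => // j _; apply: IH; have := ltn_ord j; lia.
apply: eq_integrable (integrableB (mA i) iSi ip) => // w.
rewrite inE /= => ->; rewrite big_add1 /= big_mkord sumEFin -EFinB; congr EFin.
by case: i i1 {IH ile iSi ip} => // i _ /=; rewrite big_ord_recr/= addrAC subrr add0r.
Qed.

End integrable_claims.

Unset Implicit Arguments.

Theorem theorem3p1 (R : realType) (d : measure_display)
  (Omega : measurableType d) (P : probability Omega R)
  (T : nat -> {RV P >-> \bar R}) (N : R -> Omega -> nat)
  (X : nat -> {RV P >-> R}) (L : cumulativeBounded (0 : R) (1 : R)) (t : R)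
  (m1 : R -> \bar R) (m : nat -> R * R -> \bar R) :
  (0 < t)%R ->
  arrival_times T ->
  claim_number T N ->
  mixed_poisson P N L ->
  (forall i, (1 <= i)%N -> depends_on_prev_interclaim P T N i (X i)) ->
  (* m1 y = E[X_1 | T_1 = y] *)
  regression P [set w | T 1%N w < +oo] (X 1%N) (fun w => fine (T 1%N w)) m1 ->
  (* m i (x, v) = E[X_i | T_(i-1) = x, V_i = v] *)
  (forall i, (2 <= i)%N ->
    regression P [set w | T i w < +oo] (X i)
      (fun w => (prev_time T i w, interclaim_time T i w)) (m i)) ->
  (* E[S(t)] makes sense *)
  (forall i w, (1 <= i)%N -> (0 <= X i w)%R) \/
    P.-integrable setT (EFin \o aggregate_claim N X t) ->
  \sum_(1 <= n < k) mixed_poisson_prob L t n *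
    (n%:R%:E * (\int[lebesgue_measure]_(y in `[0%R, t])
       (m1 y * ((t - y) ^+ (n - 1) / t ^+ n)%:E)) +
     \sum_(2 <= i < n.+1)
       (n`!%:R / ((i - 2)`!%:R * (n - i)`!%:R))%:E *
       \int[lebesgue_measure]_(x in `[0%R, t])
         \int[lebesgue_measure]_(v in `[0%R, (t - x)%R])
           (m i (x, v) * (x ^+ (i - 2) * (t - x - v) ^+ (n - i) / t ^+ n)%:E))
    @[k --> \oo] --> 'E_P[aggregate_claim N X t].
Proof.
move=> t0 arrT numN [Lam [Lam0 LamL poiN]] XN m1E mE HX.
have N0 := claim_number0 arrT numN.
pose A n := [set w | N t w = n].
have mA n : measurable (A n).
  by apply: (measurable_claim_number arrT numN) => //; exact: ltW.
have tA : trivIset setT A by move=> a b _ _ [w [<- <-]].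
have AT : \bigcup_n A n = setT by apply/seteqP; split => // w _; exists (N t w).
set S := aggregate_claim N X t.
have SE n w : A n w -> S w = (\sum_(j < n) X j.+1 w)%R.
  by move=> Nw; rewrite /S /aggregate_claim Nw big_add1 /= big_mkord.
have mS : measurable_fun setT S.
  rewrite -AT; apply/measurable_fun_bigcup => // n.
  apply: (eq_measurable_fun (fun w => \sum_(j < n) X j.+1 w)%R).
    by move=> w; rewrite inE => /SE.
  by apply: measurable_sum => j; apply: measurable_funTS; exact: measurable_funPT.
have Sneg : \int[P]_w (EFin \o S)^\- w < +oo.
  case: HX => [X0|iS]; last exact: integral_funeneg_lt_pinfty.
  rewrite integral0_eq ?ltry// => w _; rewrite funenegE; apply/max_idPr.
  by rewrite leeNl oppe0 lee_fin (SE (N t w))// sumr_ge0// => j _; exact: X0.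
have piE n : mixed_poisson_prob L t n = P (A n).
  by rewrite (mixed_poisson_prob_claim_number Lam0 LamL poiN N0).
have cvgS := cvg_sum_integral_partition mA tA AT mS Sneg.
rewrite [@expectation]unlock; set u := fun k => _.
suff -> : u = fun k => \sum_(0 <= n < k) \int[P]_(w in A n) (S w)%:E by exact: cvgS.
apply/funext => -[|k]; rewrite /u {u}.
  by rewrite !big_geq.
rewrite [RHS]big_ltn// [X in X + _](_ : _ = 0) ?add0e; last first.
  by apply: integral0_eq => w /SE ->; rewrite big_ord0.
rewrite !big_nat; apply: eq_bigr => n /andP[n1 _].
have [pin0|pin0] := eqVneq (mixed_poisson_prob L t n) 0.
  rewrite pin0 mul0e null_set_integral//; last by rewrite -pin0 piE.
  by apply: measurable_funTS; exact/measurable_EFinP.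
have pi_neq0 k' : (0 < k')%N -> mixed_poisson_prob L t k' != 0.
  move=> k0; apply: contra_neq pin0 => pk.
  exact: (mixed_poisson_prob_eq0 Lam0 LamL t0 k0 n1 pk).
have HXn : (forall i w, (1 <= i)%N -> (0 <= X i w)%R) \/
    (forall i, (1 <= i <= n)%N -> P.-integrable (A n) (EFin \o X i)).
  case: HX => [X0|iS]; [by left|right => j jn].
  apply: (integrable_claim mA iS) => // i l /andP[i1 il].
  case: i i1 il => [//|[|i]] _ il.
    case: l il => // l _.
    by apply: (first_claim_integrable arrT numN Lam0 LamL poiN t0 (XN 1%N isT) m1E);
       exact: pi_neq0.
  have [l' ->] : exists l', l = (i + l').+2 by exists (l - i.+2)%N; lia.
  by apply: (claim_gap_integrable arrT numN Lam0 LamL poiN t0 (XN i.+2 isT) (mE i.+2 isT));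
     exact: pi_neq0.
pose b i := if i is i'.+2 then
    (n`!%:R / ((i - 2)`!%:R * (n - i)`!%:R))%:E *
       \int[lebesgue_measure]_(x in `[0%R, t])
         \int[lebesgue_measure]_(v in `[0%R, (t - x)%R])
           (m i (x, v) * (x ^+ (i - 2) * (t - x - v) ^+ (n - i) / t ^+ n)%:E)
  else n%:R%:E * (\int[lebesgue_measure]_(y in `[0%R, t])
       (m1 y * ((t - y) ^+ (n - 1) / t ^+ n)%:E)).
have bE i : (1 <= i <= n)%N ->
    \int[P]_(w in A n) (X i w)%:E = mixed_poisson_prob L t n * b i.
  move=> i1n.
  have : (forall w, (0 <= X i w)%R) \/ P.-integrable (A n) (EFin \o X i).
    case: HXn => [X0|iX]; [left => w; apply: X0; lia|right; exact: iX].
  case: i i1n => [//|[|i]] /andP[_ il] HXi.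
    rewrite /b; case: n il {n1 HXn b} pin0 HXi => // n _ pin0 HXi.
    rewrite subn1/=.
    exact: (first_claim_expectation arrT numN Lam0 LamL poiN t0 (XN 1%N isT) m1E).
  have nE : n = (i + (n - i.+2)).+2 by lia.
  rewrite /b subSS subSS subn0.
  move: (n - i.+2)%N nE => l nE; rewrite nE in pin0 HXi *.
  exact: (claim_gap_expectation arrT numN Lam0 LamL poiN t0 (XN i.+2 isT) (mE i.+2 isT)).
have bord (j : 'I_n) : (1 <= j.+1 <= n)%N by exact: ltn_ord.
have -> : \int[P]_(w in A n) (S w)%:E = \sum_(j < n) \int[P]_(w in A n) (X j.+1 w)%:E.
  rewrite (eq_integral (fun w => \sum_(j < n) (X j.+1 w)%:E)); last first.
    by move=> w; rewrite inE => /SE ->; rewrite sumEFin.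
  case: HXn => [X0|iX].
    apply: ge0_integral_sum => // [j|j w _]; last by rewrite lee_fin X0.
    by apply: measurable_funTS; exact/measurable_EFinP/measurable_funPT.
  by apply: integral_sum => // j; exact: iX.
rewrite (eq_bigr (fun j : 'I_n => mixed_poisson_prob L t n * b j.+1)); last first.
  by move=> j _; exact: bE.
rewrite -mule_sumr_pos.
- rewrite -(big_mkord xpredT (fun j => b j.+1)) -(big_add1 _ _ 0%N n.+1 xpredT b).
  by rewrite big_ltn// /b; congr (_ * (_ + _)); apply: eq_big_nat => -[|[|i]].
- by rewrite lt0e pin0 piE measure_ge0.
- by rewrite piE fin_num_measure.
- case: HXn => [X0|iX]; [left|right] => j; rewrite -bE//.
    by apply: integral_ge0 => w _; rewrite lee_fin X0.
  exact: integrable_fin_num (iX _ (bord j)).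
Qed.
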